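(* Let $\mathfrak g$ and $\mathfrak h$ be two finite-dimensional Lie algebras and let $\Phi\colon TI\times\mathfrak g\to\mathfrak h$ be an LA-homotopy. Define $\psi\colon I\to\mathfrak g^*\otimes\mathfrak h=\operatorname{Hom}(\mathfrak g,\mathfrak h)$ by $\psi(s)(x)=\Phi(0|_s,x)$ for $s\in I$, $x\in\mathfrak g$. Then the curve $\psi$ is a trivial deformation of $\Phi_0=\psi(0)\colon\mathfrak g\to\mathfrak h$.
   Context: Lie algebras are real; $I$ is an open interval containing $0$ and $1$ with coordinate $t$; $0|_s\in T_sI$ is the zero vector. A Lie algebroid is a vector bundle $A\to M$ with an $\mathbb R$-Lie bracket on $\Gamma(A)$ and an anchor $\rho_A\colon A\to TM$ (vector bundle morphism over $\mathrm{id}_M$) such that $[a_1,fa_2]=f[a_1,a_2]+\rho_A(a_1)(f)a_2$; a Lie algebra is a Lie algebroid over a point. A vector bundle morphism between Lie algebroids is an LA-morphism if it is compatible with anchors and brackets; equivalently, if pullback of forms $\Gamma(\wedge^\bullet B^* )\to\Gamma(\wedge^\bullet A^* )$ intertwines the Lie algebroid (Koszul) differentials. $TI\times\mathfrak g\to I\times\{*\}$ is the direct product Lie algebroid: its anchor is $(v,x)\mapsto v$, and for sections $(f\partial_t,x),(g\partial_t,y)$ with $f,g\in C^\infty(I)$, $x,y\in C^\infty(I,\mathfrak g)$ the bracket is $((fg'-gf')\partial_t,[x,y]+fy'-gx')$. An LA-homotopy $\Phi\colon TI\times\mathfrak g\to\mathfrak h$ is an LA-morphism (over $I\times\{*\}\to\{*\}$),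 considered as a homotopy between $\Phi_0=\Phi(0|_0,\cdot)$ and $\Phi_1=\Phi(0|_1,\cdot)$. Such a $\Phi$ can be written $\Phi(r\partial_t|_s,x)=r\,c(s)+\psi(s)(x)$ with smooth curves $c\colon I\to\mathfrak h$ and $\psi$ as in the claim. Let $\psi_0\colon\mathfrak g\to\mathfrak h$ be a morphism of Lie algebras. A deformation of $\psi_0$ is a smooth curve $\psi\colon I\to\mathfrak g^*\otimes\mathfrak h$ on an open interval $I\ni0$ such that $\psi(t)$ is a morphism of Lie algebras for all $t\in I$ and $\psi(0)=\psi_0$. Let $H$ be the simply connected Lie group integrating $\mathfrak h$. The deformation $\psi$ is trivial if there is a smooth curve $h\colon I\to H$ with $\psi(t)=\operatorname{Ad}_{h(t)}\circ\psi_0$ for all $t\in I$. *)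

(* Defs.v *)
From HB Require Import structures.
From mathcomp Require Import all_boot all_order all_algebra.
From mathcomp Require Import all_classical all_reals all_analysis.

Set Implicit Arguments.
Unset Strict Implicit.
Unset Printing Implicit Defensive.

Import Order.TTheory GRing.Theory Num.Theory numFieldNormedType.Exports.

Local Open Scope classical_set_scope.
Local Open Scope ring_scope.

(* Smoothness. In finite dimension, [Ck k.+1] (all directional derivatives are
   of class C^k, and f is differentiable) is the usual class C^(k+1). It is only
   used for U open in a finite-dimensional space, where it depends on f
   restricted to U only. *)
Fixpoint Ck (R : realType) (E F : normedModType R) (k : nat) (U : set E)
    (f : E -> F) : Prop :=
  match k with
  | 0%N => forall x, U x -> {for x, continuous f}
  | k'.+1 => (forall x, U x -> differentiable f x) /\
             (forall v : E, Ck k' U ('D_v f))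
  end.

Definition smooth (R : realType) (E F : normedModType R) (U : set E)
  (f : E -> F) : Prop := forall k, Ck k U f.

(* A [vectType] has no canonical topology in the library: smoothness and
   derivatives of functions with values in it are read in coordinates (any basis
   gives the same notions). *)
Definition vsmooth (R : realType) (E : normedModType R) (V : vectType R)
  (U : set E) (f : E -> V) : Prop :=
  smooth U (fun x => passmx.rVof (vbasis {:V}) (f x)).

Definition vderiv (R : realType) (V : vectType R) (f : R -> V) (s : R) : V :=
  passmx.vecof (vbasis {:V}) ('D_1 (fun t : R => passmx.rVof (vbasis {:V}) (f t)) s).

Record lieAlgebra (R : realType) := LieAlgebra {
  lie_space :> vectType R;
  lie_br : lie_space -> lie_space -> lie_space;
  lie_br_linl : forall z (a : R) x y,
    lie_br (a *: x + y) z = a *: lie_br x z + lie_br y z;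
  lie_br_linr : forall z (a : R) x y,
    lie_br z (a *: x + y) = a *: lie_br z x + lie_br z y;
  lie_br_alt : forall x, lie_br x x = 0;
  lie_br_jacobi : forall x y z,
    lie_br x (lie_br y z) + lie_br y (lie_br z x) + lie_br z (lie_br x y) = 0 }.

Definition is_lie_morphism (R : realType) (g h : lieAlgebra R)
  (T : 'Hom(g, h)) : Prop :=
  forall x y, T (lie_br x y) = lie_br (T x) (T y).

(* The structure maps of a Lie algebroid on the trivial bundle with fibre
   [la_fibre] over the open subset [la_base] of a finite-dimensional space.
   Sections are functions on the ambient space, of which only the restriction
   to [la_base] matters. The two instances below are given by explicit formulas,
   so the Lie algebroid axioms are not recorded. *)
Record algebroid_data (R : realType) := AlgebroidData {
  la_space : normedModType R;
  la_base : set la_space;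
  la_fibre : vectType R;
  la_anchor : la_space -> la_fibre -> la_space;
  la_br : (la_space -> la_fibre) -> (la_space -> la_fibre) ->
          la_space -> la_fibre }.

Definition la_section (R : realType) (A : algebroid_data R)
  (a : la_space A -> la_fibre A) : Prop := vsmooth (la_base (a:=A)) a.

(* rho(a)(u) *)
Definition la_act (R : realType) (A : algebroid_data R)
  (a : la_space A -> la_fibre A) (u : la_space A -> R) (x : la_space A) : R :=
  'D_(la_anchor x (a x)) u x.

(* Compatibility with brackets, for a morphism phi over a map f: whenever two
   sections a, a' of A have decompositions
     phi o a = sum_i u_i (b_i o f),   phi o a' = sum_j u'_j (b'_j o f)
   with u_i, u'_j functions on the base of A and b_i, b'_j sections of B, then
     phi o [a, a'] = sum_ij u_i u'_j ([b_i, b'_j] o f)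
       + sum_j rho(a)(u'_j) (b'_j o f) - sum_i rho(a')(u_i) (b_i o f). *)
Definition bracket_compatible (R : realType) (A B : algebroid_data R)
    (f : la_space A -> la_space B)
    (phi : la_space A -> 'Hom(la_fibre A, la_fibre B)) : Prop :=
  forall (a a' : la_space A -> la_fibre A) (m n : nat)
    (u : 'I_m -> la_space A -> R) (b : 'I_m -> la_space B -> la_fibre B)
    (u' : 'I_n -> la_space A -> R) (b' : 'I_n -> la_space B -> la_fibre B),
    la_section a -> la_section a' ->
    (forall i, smooth (la_base (a:=A)) (u i)) -> (forall i, la_section (b i)) ->
    (forall j, smooth (la_base (a:=A)) (u' j)) -> (forall j, la_section (b' j)) ->
    (forall x, la_base x -> phi x (a x) = \sum_(i < m) u i x *: b i (f x)) ->
    (forall x, la_base x -> phi x (a' x) = \sum_(j < n) u' j x *: b' j (f x)) ->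
  forall x, la_base x ->
    phi x (la_br a a' x) =
      \sum_(i < m) \sum_(j < n) (u i x * u' j x) *: la_br (b i) (b' j) (f x)
      + \sum_(j < n) la_act a (u' j) x *: b' j (f x)
      - \sum_(i < m) la_act a' (u i) x *: b i (f x).

Definition LA_morphism (R : realType) (A B : algebroid_data R)
    (f : la_space A -> la_space B)
    (phi : la_space A -> 'Hom(la_fibre A, la_fibre B)) : Prop :=
  [/\ (forall x, la_base x -> la_base (f x)) /\ smooth (la_base (a:=A)) f,
      vsmooth (la_base (a:=A)) phi,
      (forall x v, la_base x ->
         'D_(la_anchor x v) f x = la_anchor (f x) (phi x v)) &
      bracket_compatible f phi].

(* TI x g, the tangent bundle TI being trivialised by the coordinate field *)
Definition TI_times (R : realType) (I : set R) (g : lieAlgebra R) :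
    algebroid_data R :=
  @AlgebroidData R R I (R^o * g)%type
    (fun _ v => v.1)
    (fun a b s =>
       ((a s).1 * 'D_1 (fun t : R => (b t).1 : R) s
          - (b s).1 * 'D_1 (fun t : R => (a t).1 : R) s,
        lie_br (a s).2 (b s).2
          + (a s).1 *: vderiv (fun t => (b t).2) s
          - (b s).1 *: vderiv (fun t => (a t).2) s)).

(* a Lie algebra as a Lie algebroid over the point 'rV_0 *)
Definition over_point (R : realType) (h : lieAlgebra R) : algebroid_data R :=
  @AlgebroidData R 'rV[R]_0 setT h (fun _ _ => 0)
    (fun a b p => lie_br (a p) (b p)).

(* [Phi s (r, x)] is the value of Phi at (r d/dt|_s, x) *)
Definition LA_homotopy (R : realType) (I : set R) (g h : lieAlgebra R)
    (Phi : R -> 'Hom((R^o * g)%type, h)) : Prop :=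
  @LA_morphism R (TI_times I g) (over_point h) (fun _ => 0) Phi.

Record chart (R : realType) (M : topologicalType) (E : normedModType R) :=
  Chart { dom : set M; fwd : M -> E; bwd : E -> M }.

Definition is_chart (R : realType) (M : topologicalType) (E : normedModType R)
    (c : chart M E) : Prop :=
  [/\ open (dom c), open (fwd c @` dom c),
      {within dom c, continuous (fwd c)},
      {within fwd c @` dom c, continuous (bwd c)} &
      forall x, dom c x -> bwd c (fwd c x) = x].

Definition is_atlas (R : realType) (M : topologicalType) (E : normedModType R)
    (A : set (chart M E)) : Prop :=
  [/\ forall c, A c -> is_chart c,
      forall x, exists2 c, A c & dom c x &
      forall c d, A c -> A d ->
        smooth (fwd c @` (dom c `&` dom d)) (fun y => fwd d (bwd c y))].

Definition prod_chart (R : realType) (M N : topologicalType)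
    (E F : normedModType R) (c : chart M E) (d : chart N F) :
    chart (M * N)%type (E * F)%type :=
  Chart (dom c `*` dom d) (fun p => (fwd c p.1, fwd d p.2))
        (fun p => (bwd c p.1, bwd d p.2)).

Definition prod_atlas (R : realType) (M N : topologicalType)
    (E F : normedModType R) (A : set (chart M E)) (B : set (chart N F)) :
    set (chart (M * N)%type (E * F)%type) :=
  [set e | exists c d, [/\ A c, B d & e = prod_chart c d]].

Definition model_atlas (R : realType) (E : normedModType R) : set (chart E E) :=
  [set Chart setT id id].

(* smooth maps, on an open subset U of a manifold *)
Definition smooth_map (R : realType) (M N : topologicalType)
    (E F : normedModType R) (A : set (chart M E)) (B : set (chart N F))
    (U : set M) (f : M -> N) : Prop :=
  (forall x, U x -> {for x, continuous f}) /\
  forall c d, A c -> B d ->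
    smooth (fwd c @` (dom c `&` U `&` f @^-1` dom d))
           (fun y => fwd d (f (bwd c y))).

Record lieGroup (R : realType) := LieGroup {
  lg_space :> topologicalType;
  lg_dim : nat;
  lg_atlas : set (chart lg_space 'rV[R]_lg_dim);
  lg_mul : lg_space -> lg_space -> lg_space;
  lg_one : lg_space;
  lg_inv : lg_space -> lg_space;
  lg_hausdorff : hausdorff_space lg_space;
  lg_second_countable : @second_countable lg_space;
  lg_is_atlas : is_atlas lg_atlas;
  lg_mulA : forall x y z, lg_mul x (lg_mul y z) = lg_mul (lg_mul x y) z;
  lg_mul1 : forall x, lg_mul lg_one x = x;
  lg_mulV : forall x, lg_mul (lg_inv x) x = lg_one;
  lg_mul_smooth : smooth_map (prod_atlas lg_atlas lg_atlas) lg_atlas setT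
    (fun p : lg_space * lg_space => lg_mul p.1 p.2);
  lg_inv_smooth : smooth_map lg_atlas lg_atlas setT lg_inv }.

Definition simply_connected (R : realType) (M : topologicalType) : Prop :=
  (forall x y : M, exists gamma : R -> M,
     [/\ {within `[0, 1], continuous gamma}, gamma 0 = x & gamma 1 = y]) /\
  (forall gamma : R -> M,
     {within `[0, 1], continuous gamma} -> gamma 0 = gamma 1 ->
     exists K : R * R -> M,
       {within `[0, 1] `*` `[0, 1], continuous K} /\
       forall s, `[0, 1]%classic s ->
         [/\ K (0, s) = gamma s, K (1, s) = gamma 0,
             K (s, 0) = gamma 0 & K (s, 1) = gamma 0]).

(* The tangent space of a Lie group at 1 is read in a chart c around 1. In this
   chart, [left_inv_field c u] is the left-invariant vector field with value u
   at 1, and [tangent_br c u v] is the value at 1 of the bracket of vector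
   fields [X, Y] = D_X Y - D_Y X of the left-invariant extensions of u and v. *)
Definition left_inv_field (R : realType) (H : lieGroup R)
    (c : chart H 'rV[R]_(lg_dim H)) (u y : 'rV[R]_(lg_dim H)) :
    'rV[R]_(lg_dim H) :=
  'D_u (fun z => fwd c (lg_mul (bwd c y) (bwd c z))) (fwd c (lg_one H)).

Definition tangent_br (R : realType) (H : lieGroup R)
    (c : chart H 'rV[R]_(lg_dim H)) (u v : 'rV[R]_(lg_dim H)) :
    'rV[R]_(lg_dim H) :=
  'D_u (left_inv_field c v) (fwd c (lg_one H))
  - 'D_v (left_inv_field c u) (fwd c (lg_one H)).

(* An isomorphism of h with the Lie algebra of H *)
Record integrates (R : realType) (H : lieGroup R) (h : lieAlgebra R) :=
  Integrates {
  int_chart : chart H 'rV[R]_(lg_dim H);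
  int_iso : {linear h -> 'rV[R]_(lg_dim H)};
  int_inv : 'rV[R]_(lg_dim H) -> h;
  int_chart_atlas : lg_atlas int_chart;
  int_chart_one : dom int_chart (lg_one H);
  int_isoK : cancel int_iso int_inv;
  int_invK : cancel int_inv int_iso;
  int_iso_br : forall x y,
    int_iso (lie_br x y) = tangent_br int_chart (int_iso x) (int_iso y) }.

(* the derivative at 1 of the conjugation by k, transported to h *)
Definition Ad (R : realType) (H : lieGroup R) (h : lieAlgebra R)
    (i : integrates H h) (k : H) (x : h) : h :=
  int_inv i
    ('D_(int_iso i x)
       (fun z => fwd (int_chart i)
          (lg_mul (lg_mul k (bwd (int_chart i) z)) (lg_inv k)))
       (fwd (int_chart i) (lg_one H))).

Definition open_interval (R : realType) (I : set R) : Prop :=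
  open I /\ is_interval I.

Definition is_deformation (R : realType) (I : set R) (g h : lieAlgebra R)
    (psi0 : 'Hom(g, h)) (psi : R -> 'Hom(g, h)) : Prop :=
  [/\ open_interval I /\ I 0,
      is_lie_morphism psi0,
      vsmooth I psi,
      forall t, I t -> is_lie_morphism (psi t) &
      psi 0 = psi0].

Definition is_trivial_deformation (R : realType) (I : set R)
    (g h : lieAlgebra R) (H : lieGroup R) (i : integrates H h)
    (psi0 : 'Hom(g, h)) (psi : R -> 'Hom(g, h)) : Prop :=
  is_deformation I psi0 psi /\
  exists k : R -> H,
    smooth_map (@model_atlas R R) (@lg_atlas R H) I k /\
    forall t, I t -> forall x, psi t x = Ad i (k t) (psi0 x).

(* Main.v *)
Require Import Defs.
From HB Require Import structures.
From mathcomp Require Import all_boot all_order all_algebra.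
From mathcomp Require Import ring lra.
From mathcomp Require Import all_classical all_reals all_analysis.

Set Implicit Arguments.
Unset Strict Implicit.
Unset Printing Implicit Defensive.

Import Order.TTheory GRing.Theory Num.Theory numFieldNormedType.Exports.

Local Open Scope classical_set_scope.
Local Open Scope ring_scope.

(** Write [Phi (r d/dt|_s, x) = r c(s) + psi(s)(x)]. Compatibility with brackets
    on constant sections says that every [psi(s)] is a Lie morphism and that
    [psi' = -[c, psi]]. Let [j] be the curve in [H] with [j(0) = 1] and left
    logarithmic derivative [c]: it exists locally by Picard iteration in a chart
    at 1, and globally on [I] because the equation is left invariant. Then
    [(Ad_j psi)' = Ad_j ([c, psi] + psi') = 0], so [psi = Ad_(j^-1) psi(0)].
    The logarithmic derivative of [j] at [t] is read as the derivative at [t] of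
    the curve [j(t)^-1 j], which stays in a chart at 1 near [t]. *)

(** * Smooth maps between normed spaces *)

(** The bracket of the Lie algebra of [H] is that of left-invariant vector fields in a chart, so the
    formula (Ad_j)' = Ad_j ad_c must itself be proved. It comes from (y z y^-1) y = y z:
    differentiating in z and then in y at 1 expresses the derivative of Ad by second derivatives of
    the product, and the symmetry of mixed partials leaves exactly the bracket. The sign in psi' =
    -[c, psi] arises because d/dt commutes with the constant section x, so that 0 = [c, psi x] +
    psi' x. Uniqueness for a given logarithmic derivative uses the group: j1 j2^-1 has zero
    logarithmic derivative, hence is locally constant. Local solutions translated to agree at one
    point therefore agree on the whole overlap and can be glued, and the points of [I] reached from
    0 form an open and closed subset. *)

Section Ck_calculus.
Variable R : realType.
Implicit Types E F G : normedModType R.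

Lemma Ck_mono E F k (U V : set E) (f : E -> F) :
  U `<=` V -> Ck k V f -> Ck k U f.
Proof.
elim: k f => [|k IH] f UV /=; first by move=> cf x /UV; apply: cf.
by move=> [df Df]; split=> [x /UV|v]; [exact: df|exact: IH].
Qed.

(** [Ck] is a conjunction of conditions at single points, so the sets [V] may vary with the point
    and need not be open. *)
Lemma Ck_local E F k (U : set E) (f : E -> F) :
  (forall x, U x -> exists2 V : set E, V x & Ck k V f) -> Ck k U f.
Proof.
elim: k f => [|k IH] f /= H.
  by move=> x Ux; have [V Vx /(_ _ Vx)] := H x Ux.
split=> [x Ux|v]; first by have [V Vx [df _]] := H x Ux; exact: df.
by apply: IH => x Ux; have [V Vx [_ Df]] := H x Ux; exists V.
Qed.

(** The first-order expansion of [f] at [x] is also one of [g]; uniqueness of such expansions then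
    identifies ['d g x] with ['d f x]. *)
Lemma near_eq_differentiable E F (f g : E -> F) (x : E) :
  (\forall y \near x, f y = g y) -> differentiable f x -> differentiable g x.
Proof.
move=> fg df; have fgx : f x = g x by exact: nbhs_singleton fg.
have c : continuous ('d f x) by exact: diff_continuous.
have e : g \o shift x = cst (g x) + 'd f x +o_ (0 : E) id.
  apply/eqaddoP => eps eps0.
  have /eqaddoP/(_ _ eps0) H := diff_locally df.
  move: fg; rewrite (near_shift 0) => fg.
  near=> h; rewrite /= !fctE /= -fgx.
  have <- : f (h + x) = g (h + x).
    have : (f (h + (x - 0)) = g (h + (x - 0))) by near: h.
    by rewrite subr0.
  by near: h.
apply/diff_locallyP.
by have -> : 'd g x = 'd f x :> (E -> F) by exact: diff_unique.
Unshelve. all: by end_near. Qed.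

(** On an open [U], agreement at all points of [U] is agreement near each of them, which passes to
    all derivatives. This is how rules of calculus valid only on [U] enter an induction on [k]. *)
Lemma Ck_near E F k (U : set E) (f g : E -> F) :
  open U -> (forall x, U x -> f x = g x) -> Ck k U f -> Ck k U g.
Proof.
move=> oU; elim: k f g => [|k IH] f g fg /=.
  move=> cf x Ux; have cfx := cf x Ux.
  change (g @ x --> g x).
  have -> : g x = f x by rewrite fg.
  apply: cvg_trans cfx; apply: near_eq_cvg.
  near=> y; apply/fg; near: y; exact: open_nbhs_nbhs.
have fgn x : U x -> \forall y \near x, f y = g y.
  by move=> Ux; near=> y; apply/fg; near: y; exact: open_nbhs_nbhs.
move=> [df Df]; split=> [x Ux|v].
  by apply: near_eq_differentiable (df x Ux); exact: fgn.
apply: IH (Df v) => x Ux; exact/near_eq_derive/fgn.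
Unshelve. all: by end_near. Qed.

Lemma CkW E F k (U : set E) (f : E -> F) : Ck k.+1 U f -> Ck k U f.
Proof.
elim: k f => [|k IH] f [df Df].
  by move=> x Ux; exact/differentiable_continuous/df.
by split=> // v; exact/IH/Df.
Qed.

Lemma Ck_cst E F k (U : set E) (a : F) : Ck k U (fun=> a : F).
Proof.
elim: k a => [|k IH] a /=; first by move=> x _; exact: cst_continuous.
split=> [x _|v]; first exact: differentiable_cst.
have -> : 'D_v (fun=> a) = (fun=> 0) :> (E -> F).
  by apply/funext => x; rewrite derive_cst.
exact: IH.
Qed.

Lemma Ck_lin E F k (U : set E) (L : {linear E -> F}) :
  continuous L -> Ck k U L.
Proof.
move=> cL; case: k => [|k] /=; first by move=> x _; exact: cL.
split=> [x _|v]; first exact: linear_differentiable.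
have -> : 'D_v L = (fun=> L v) :> (E -> F).
  apply/funext => x; rewrite deriveE; last exact: linear_differentiable.
  by rewrite diff_lin.
exact: Ck_cst.
Qed.

Lemma Ck_add E F k (U : set E) (f g : E -> F) :
  open U -> Ck k U f -> Ck k U g -> Ck k U (fun x => f x + g x).
Proof.
move=> oU; elim: k f g => [|k IH] f g /=.
  by move=> cf cg x Ux; apply: continuousD; [exact: cf|exact: cg].
move=> [df Df] [dg Dg]; split=> [x Ux|v].
  by apply: differentiableD; [exact: df|exact: dg].
apply: (@Ck_near _ _ _ _ (fun x => 'D_v f x + 'D_v g x)) => //; last exact: IH.
move=> x Ux; have dfx := df _ Ux; have dgx := dg _ Ux.
by rewrite [RHS]deriveD//; exact: diff_derivable.
Qed.

Lemma Ck_sum E F k (U : set E) (I : Type) (r : seq I) (f : I -> E -> F) :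
  open U -> (forall i, Ck k U (f i)) -> Ck k U (fun x => \sum_(i <- r) f i x).
Proof.
move=> oU cf; elim: r => [|i r IH].
  apply: (@Ck_near _ _ _ _ (fun=> 0)) => //; last exact: Ck_cst.
  by move=> x _; rewrite big_nil.
apply: (@Ck_near _ _ _ _ (fun x => f i x + \sum_(i <- r) f i x)) => //.
  by move=> x _; rewrite big_cons.
exact: Ck_add.
Qed.

(** Chain rule for the bilinear map (r, v) -> r v after the pair (a, f). *)
Lemma is_diff_scale E F (a : E -> R) (f : E -> F) (x : E) :
  differentiable a x -> differentiable f x ->
  is_diff x (fun y => a y *: f y)
    (fun v => a x *: 'd f x v + 'd a x v *: f x).
Proof.
move=> da df.
have sc : continuous (fun p : R * F => (p.1 : R) *: p.2).
  exact: scale_continuous.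
have bil : bilinear_for
    (GRing.Scale.Law.clone _ _ *:%R _) (GRing.Scale.Law.clone _ _ *:%R _)
    (@GRing.scale R F : R -> F -> F).
  split=> [u'|u] b y z /=; first by rewrite scalerDl scalerA.
  by rewrite scalerDr !scalerA mulrC.
pose bM := bilinear_isBilinear.Build R R F F _ _ _ bil.
pose b : {bilinear R -> F -> F} := HB.pack (@GRing.scale R F : R -> F -> F) bM.
have -> : (fun y => a y *: f y) = (fun p => b p.1 p.2) \o (fun y => (a y, f y)).
  by [].
have dp : differentiable (fun y => (a y, f y)) x by exact: differentiable_pair.
have db : differentiable (fun p => b p.1 p.2) (a x, f x).
  exact: differentiable_bilin.
split; first exact: differentiable_comp.
by rewrite diff_comp// diff_bilin// diff_pair.
Qed.

Lemma Ck_scale E F k (U : set E) (a : E -> R) (f : E -> F) :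
  open U -> Ck k U a -> Ck k U f -> Ck k U (fun x => a x *: f x).
Proof.
move=> oU; elim: k a f => [|k IH] a f /=.
  by move=> ca cf x Ux; apply: continuousZ; [exact: ca|exact: cf].
move=> ca cf; have {}[[da Da] [df Df]] := (ca, cf).
have D x : U x -> is_diff x (fun y => a y *: f y)
    (fun v => a x *: 'd f x v + 'd a x v *: f x).
  by move=> Ux; apply: is_diff_scale; [exact: da|exact: df].
split=> [x /D[]//|v].
apply: (@Ck_near _ _ _ _ (fun x => a x *: 'D_v f x + 'D_v a x *: f x)) => //.
  move=> x Ux; have [d e] := D _ Ux.
  by rewrite [RHS]deriveE// e !deriveE//; [exact: da|exact: df].
by apply: Ck_add => //; apply: IH => //; exact: CkW.
Qed.

Lemma Ck_lincomp E F G k (U : set E) (L : {linear F -> G}) (f : E -> F) :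
  open U -> continuous L -> Ck k U f -> Ck k U (fun x => L (f x)).
Proof.
move=> oU cL; elim: k f => [|k IH] f /=.
  move=> cf x Ux; apply: continuous_comp; [exact: cf|exact: cL].
move=> [df Df]; have dL y : differentiable L y by exact: linear_differentiable.
split=> [x Ux|v].
  exact: (@differentiable_comp _ _ _ _ f L x (df x Ux)).
apply: Ck_near (IH _ (Df v)) => // x Ux; have dfx := df x Ux.
rewrite [RHS](@deriveE _ _ _ (L \o f)); last exact: differentiable_comp.
by rewrite diff_comp// diff_lin//= deriveE.
Qed.

Lemma Ck_pair E F G k (U : set E) (f : E -> F) (g : E -> G) :
  open U -> Ck k U f -> Ck k U g -> Ck k U (fun x => (f x, g x)).
Proof.
move=> oU; elim: k f g => [|k IH] f g /=.
  by move=> cf cg x Ux; exact: (cvg_pair (cf x Ux) (cg x Ux)).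
move=> [df Df] [dg Dg]; split=> [x Ux|v].
  by apply: differentiable_pair; [exact: df|exact: dg].
apply: (@Ck_near _ _ _ _ (fun x => ('D_v f x, 'D_v g x))) => //; last exact: IH.
move=> x Ux; have dfx := df x Ux; have dgx := dg x Ux.
rewrite [RHS]deriveE; last exact: differentiable_pair.
by rewrite diff_pair// !deriveE.
Qed.

(* Finite-dimensionality, as needed to expand a differential in partial
   derivatives. *)
Definition has_frame F := exists (I : finType) (e : I -> F)
  (l : I -> {linear F -> R}),
  (forall i, continuous (l i)) /\ forall x, x = \sum_i l i x *: e i.

(** [Ck] speaks of derivatives in fixed directions, whereas the chain rule differentiates [g] in the
    moving direction ['D_v f x]. A frame of [F] turns this into a finite sum of coordinates of
    ['D_v f] times the fixed derivatives ['D_(e i) g], to which the induction applies. *)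
Lemma Ck_comp E F G k (U : set E) (V : set F) (f : E -> F) (g : F -> G) :
  has_frame F -> open U -> open V -> (forall x, U x -> V (f x)) ->
  Ck k U f -> Ck k V g -> Ck k U (fun x => g (f x)).
Proof.
move=> [I [e [l [cl el]]]] oU oV UV; elim: k g => [|k IH] g /=.
  move=> cf cg x Ux.
  exact: (@continuous_comp _ _ _ f g x (cf x Ux) (cg _ (UV _ Ux))).
move=> cf [dg Dg]; have [df Df] := cf; split=> [x Ux|v].
  exact: (@differentiable_comp _ _ _ _ f g x (df x Ux) (dg _ (UV _ Ux))).
apply: (@Ck_near _ _ _ _
  (fun x => \sum_i l i ('D_v f x) *: 'D_(e i) g (f x))) => //; last first.
  apply: Ck_sum => // i; apply: Ck_scale => //.
    exact: Ck_lincomp.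
  by apply: (IH ('D_(e i) g)) => //; exact: CkW.
move=> x Ux; have dfx := df _ Ux; have dgx := dg _ (UV _ Ux).
rewrite [RHS](@deriveE _ _ _ (g \o f)); last exact: differentiable_comp.
rewrite diff_comp//= [in RHS](el ('d f x v)) linear_sum.
by apply: eq_bigr => i _; rewrite linearZ/= !deriveE.
Qed.

Lemma has_frame_R : has_frame R.
Proof.
exists unit, (fun=> 1), (fun=> idfun); split=> [i x|x]; first exact: cvg_id.
by rewrite big_const card_unit /= addr0 [RHS]mulr1.
Qed.

Lemma has_frame_row n : has_frame 'rV[R]_n.
Proof.
pose l (i : 'I_n) (v : 'rV[R]_n) : R := v 0 i.
have ll i : linear (l i) by move=> a u v; rewrite /l !mxE.
pose L i : {linear 'rV[R]_n -> R} :=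
  HB.pack (l i) (GRing.isLinear.Build _ _ _ _ _ (ll i)).
exists 'I_n, (fun i => delta_mx 0 i), L.
split=> [i|x]; first exact: coord_continuous.
exact: row_sum_delta.
Qed.

Lemma has_frame_prod F G : has_frame F -> has_frame G -> has_frame (F * G)%type.
Proof.
move=> [I [e [l [cl el]]]] [J [e' [l' [cl' el']]]].
exists (I + J)%type, (fun k => match k with inl i => (e i, 0) | inr j => (0, e' j) end).
exists (fun k => match k with inl i => [the {linear _ -> _} of l i \o fst]
                 | inr j => [the {linear _ -> _} of l' j \o snd] end).
split=> [[i|j] p /=|[x y]].
- by apply: continuous_comp; [exact: cvg_fst|exact: cl].
- by apply: continuous_comp; [exact: cvg_snd|exact: cl'].
rewrite big_sumType /=.
rewrite [RHS]surjective_pairing; congr (_, _).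
  rewrite [RHS]raddfD [in RHS]/= !(raddf_sum (@fst F G)) [LHS]el -[LHS]addr0.
  congr (_ + _); by rewrite big1// => j _; exact: scaler0.
rewrite [RHS]raddfD [in RHS]/= !(raddf_sum (@snd F G)) [LHS]el' -[LHS]add0r.
congr (_ + _); by rewrite big1// => j _; exact: scaler0.
Qed.

End Ck_calculus.

(** * Germs of smooth maps and the symmetry of second derivatives *)

Section smooth_near.
Variable R : realType.
Implicit Types E F G : normedModType R.

(** Smoothness of a germ: composites of charts and group operations are defined on shrinking
    domains, which need not be named in this form. *)
Definition smooth_near E F (f : E -> F) (x : E) : Prop :=
  exists U : set E, [/\ open U, U x & smooth U f].

Lemma smooth_near_nbhs E F (S : set E) (f : E -> F) x :
  nbhs x S -> smooth S f -> smooth_near f x.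
Proof.
move=> Sx fS; exists S°; split; first exact: open_interior.
  exact: Sx.
by move=> k; apply: Ck_mono (fS k); exact: interior_subset.
Qed.

Lemma smooth_near_eq E F (f g : E -> F) x :
  (\forall y \near x, f y = g y) -> smooth_near f x -> smooth_near g x.
Proof.
move=> fg [U [oU Ux fU]].
exists (U `&` [set y | f y = g y]°); split.
- by apply: openI => //; exact: open_interior.
- by split.
- move=> k; apply: (@Ck_near _ _ _ _ _ f).
  + by apply: openI => //; exact: open_interior.
  + by move=> y [_ /interior_subset].
  + by apply: Ck_mono (fU k); exact: subIsetl.
Qed.

Lemma near_smooth_near E F (f : E -> F) x :
  smooth_near f x -> \forall y \near x, smooth_near f y.
Proof.
move=> [U [oU Ux fU]]; near=> y; exists U; split=> //.
by near: y; exact: open_nbhs_nbhs.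
Unshelve. all: by end_near. Qed.

Lemma smooth_nearP E F (U : set E) (f : E -> F) :
  (forall x, U x -> smooth_near f x) -> smooth U f.
Proof.
move=> H k; apply: Ck_local => x /H [V [_ Vx fV]].
by exists V => //; exact: fV.
Qed.

Lemma smooth_near_differentiable E F (f : E -> F) x :
  smooth_near f x -> differentiable f x.
Proof. by move=> [U [_ Ux /(_ 1%N)[df _]]]; exact: df. Qed.

Lemma smooth_near_continuous E F (f : E -> F) x :
  smooth_near f x -> {for x, continuous f}.
Proof.
by move=> /smooth_near_differentiable; exact: differentiable_continuous.
Qed.

Lemma smooth_near_derive E F (f : E -> F) x v :
  smooth_near f x -> smooth_near ('D_v f) x.
Proof.
by move=> [U [oU Ux fU]]; exists U; split=> // k; have [_] := fU k.+1; apply.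
Qed.

Lemma smooth_near_comp E F G (f : E -> F) (g : F -> G) x :
  has_frame F -> smooth_near f x -> smooth_near g (f x) ->
  smooth_near (fun y => g (f y)) x.
Proof.
move=> hF fx [V [oV Vfx gV]]; have [U [oU Ux fU]] := fx.
have : nbhs x (f @^-1` V).
  by apply: (smooth_near_continuous fx); exact: open_nbhs_nbhs.
rewrite nbhsE => -[W [oW Wx] WV].
exists (U `&` W); split=> [||k]; [exact: openI|by []|].
apply: (@Ck_comp _ _ _ _ _ _ V) => //; first exact: openI.
  by move=> y [_ /WV].
by apply: Ck_mono (fU k); exact: subIsetl.
Qed.

Lemma smooth_near_pair E F G (f : E -> F) (g : E -> G) x :
  smooth_near f x -> smooth_near g x -> smooth_near (fun y => (f y, g y)) x.
Proof.
move=> [U [oU Ux fU]] [V [oV Vx gV]].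
have oUV : open (U `&` V) by exact: openI.
exists (U `&` V); split=> // k; apply: Ck_pair => //.
  by apply: Ck_mono (fU k); exact: subIsetl.
by apply: Ck_mono (gV k); exact: subIsetr.
Qed.

Lemma smooth_near_scale E F (a : E -> R) (f : E -> F) x :
  smooth_near a x -> smooth_near f x -> smooth_near (fun y => a y *: f y) x.
Proof.
move=> [U [oU Ux fU]] [V [oV Vx gV]].
have oUV : open (U `&` V) by exact: openI.
exists (U `&` V); split=> // k; apply: Ck_scale => //.
  by apply: Ck_mono (fU k); exact: subIsetl.
by apply: Ck_mono (gV k); exact: subIsetr.
Qed.

Lemma smooth_near_add E F (f g : E -> F) x :
  smooth_near f x -> smooth_near g x -> smooth_near (fun y => f y + g y) x.
Proof.
move=> [U [oU Ux fU]] [V [oV Vx gV]].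
have oUV : open (U `&` V) by exact: openI.
exists (U `&` V); split=> // k; apply: Ck_add => //.
  by apply: Ck_mono (fU k); exact: subIsetl.
by apply: Ck_mono (gV k); exact: subIsetr.
Qed.

Lemma smooth_near_cst E F (a : F) (x : E) : smooth_near (fun=> a) x.
Proof. by exists setT; split=> // [|k]; [exact: openT|exact: Ck_cst]. Qed.

Lemma smooth_near_lin E F (L : {linear E -> F}) (x : E) :
  continuous L -> smooth_near L x.
Proof. by move=> cL; exists setT; split=> // [|k]; [exact: openT|exact: Ck_lin]. Qed.

Lemma smooth_near_id E (x : E) : smooth_near id x.
Proof.
by apply: (@smooth_near_lin _ _ [the {linear E -> E} of idfun]) => y; exact: cvg_id.
Qed.

Lemma differentiable_is_derive E F (f : E -> F) x v :
  differentiable f x -> is_derive x v f ('D_v f x).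
Proof. by move=> df; apply: derivableP; exact: diff_derivable. Qed.

Lemma derive_pair E F G (f : E -> F) (g : E -> G) x v :
  differentiable f x -> differentiable g x ->
  'D_v (fun y => (f y, g y)) x = ('D_v f x, 'D_v g x).
Proof.
move=> df dg; have dfg : differentiable (fun y => (f y, g y)) x.
  exact: differentiable_pair.
by rewrite (deriveE _ df) (deriveE _ dg) (deriveE _ dfg) diff_pair.
Qed.

Lemma is_derive_pair E F (a : R -> E) (b : R -> F) (t : R) v w :
  is_derive t 1 a v -> is_derive t 1 b w ->
  is_derive t 1 (fun s => (a s, b s)) (v, w).
Proof.
move=> [/derivable1_diffP da <-] [/derivable1_diffP db <-].
apply: DeriveDef; last exact: derive_pair.
exact/derivable1_diffP/differentiable_pair.
Qed.

Lemma is_derive_comp_curve E F (f : E -> F) (c : R -> E) (t : R) (v : E) :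
  is_derive t 1 c v -> differentiable f (c t) ->
  is_derive t 1 (fun s => f (c s)) ('D_v f (c t)).
Proof.
move=> dc df; have [/derivable1_diffP dct <-] := dc.
have dfc : differentiable (f \o c) t by exact: differentiable_comp.
apply: DeriveDef; first exact: diff_derivable.
rewrite (@deriveE _ _ _ (f \o c))// diff_comp//= deriveE//.
by rewrite deriveE.
Qed.

Lemma is_derive_line E (p a : E) (t : R) :
  is_derive t 1 (fun s : R => p + s *: a) a.
Proof.
have d : is_derive t 1 (fun s : R => s *: a) a.
  have da := is_diff_scalel t a.
  apply: DeriveDef; first exact/derivable1_diffP.
  by rewrite deriveE// diff_val scale1r.
by have := is_deriveD (is_derive_cst p t 1) d; rewrite add0r.
Qed.

Lemma MVT_cc (u du : R -> R) (h : R) : 0 < h ->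
  (forall s, 0 <= s <= h -> is_derive s 1 u (du s)) ->
  exists2 s, 0 <= s <= h & u h - u 0 = h * du s.
Proof.
move=> h0 H; have Hi s : s \in `]0, h[%R -> is_derive s 1 u (du s).
  by rewrite in_itv/= => /andP[/ltW s0 /ltW sh]; apply: H; rewrite s0.
have [|s] := MVT h0 Hi.
  apply: continuous_in_subspaceT => s; rewrite inE/= in_itv/= => sh.
  have [d _] := H s sh.
  by apply: differentiable_continuous; exact/derivable1_diffP.
rewrite in_itv/= subr0 mulrC => /andP[/ltW s0 /ltW sh] e.
by exists s => //; rewrite s0.
Qed.

(** The mean value theorem is applied along [a] to the increment of [f] in direction [h b], then
    along [b] to ['D_a f]. *)
Lemma second_difference E (f : E -> R) (p a b : E) (h : R) : 0 < h ->
  (forall s t, 0 <= s <= h -> 0 <= t <= h ->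
    differentiable f (p + s *: a + t *: b) /\
    differentiable ('D_a f) (p + s *: a + t *: b)) ->
  exists s t, [/\ 0 <= s <= h, 0 <= t <= h &
   f (p + h *: a + h *: b) - f (p + h *: a) - (f (p + h *: b) - f p) =
   h * h * 'D_b ('D_a f) (p + s *: a + t *: b)].
Proof.
move=> h0 H; have h00 : (0 : R) <= 0 <= h by rewrite lexx ltW.
have hh : 0 <= h <= h by rewrite lexx ltW.
pose u s := f (p + s *: a + h *: b) - f (p + s *: a).
have [|s sh] := @MVT_cc u (fun s => 'D_a f (p + s *: a + h *: b) - 'D_a f (p + s *: a)) h h0.
  move=> s sh; apply: is_deriveB.
    under eq_fun do rewrite addrAC.
    rewrite addrAC.
    apply: (@is_derive_comp_curve _ _ f (fun s => p + h *: b + s *: a)).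
      exact: is_derive_line.
    by rewrite addrAC; have [] := H _ _ sh hh.
  apply: (@is_derive_comp_curve _ _ f (fun s => p + s *: a)).
    exact: is_derive_line.
  by have [] := H _ _ sh h00; rewrite scale0r addr0.
have [|t th] := @MVT_cc (fun t => 'D_a f (p + s *: a + t *: b)) (fun t => 'D_b ('D_a f) (p + s *: a + t *: b)) h h0.
  move=> t th; apply: (@is_derive_comp_curve _ _ ('D_a f) (fun t => p + s *: a + t *: b)).
    exact: is_derive_line.
  by have [] := H _ _ sh th.
rewrite scale0r addr0 => e2 e1; exists s, t; split=> //.
by rewrite -mulrA -e2 -e1 /u scale0r addr0.
Qed.

(** The second difference over a parallelogram is symmetric in [a] and [b]. It equals h^2 times
    either mixed derivative at some point of the parallelogram, and by continuity both values are
    within [eps / 2] of those at [p]. *)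
Lemma derive_comm_real E (f : E -> R) (p a b : E) :
  smooth_near f p -> 'D_a ('D_b f) p = 'D_b ('D_a f) p.
Proof.
move=> fp; apply/eqP; rewrite -subr_eq0 -normr_le0.
suff H (eps : R) : 0 < eps -> `|'D_a ('D_b f) p - 'D_b ('D_a f) p| <= eps.
  by apply/ler_addgt0Pr => eps eps0; rewrite add0r; exact: H.
move=> eps0.
have cG c d : {for p, continuous ('D_c ('D_d f))}.
  by apply: smooth_near_continuous; do 2 apply: smooth_near_derive.
have e20 : 0 < eps / 2 by rewrite divr_gt0.
pose P q := [/\ smooth_near f q, `|'D_a ('D_b f) p - 'D_a ('D_b f) q| < eps / 2
   & `|'D_b ('D_a f) p - 'D_b ('D_a f) q| < eps / 2].
have N1 := near_smooth_near fp.
have N2 : \forall q \near p, `|'D_a ('D_b f) p - 'D_a ('D_b f) q| < eps / 2.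
  by have /cvgrPdist_lt := cG a b; apply.
have N3 : \forall q \near p, `|'D_b ('D_a f) p - 'D_b ('D_a f) q| < eps / 2.
  by have /cvgrPdist_lt := cG b a; apply.
have : \forall q \near p, P q.
  by apply: filterS3 N1 N2 N3 => q; split.
move=> /nbhs_ballP[d /= d0 dP].
(* The parallelogram with sides [h a] and [h b] then lies in the ball of radius [d]; the added 1
   keeps the denominator positive when [a] and [b] vanish. *)
pose h := d / 2 / (`|a| + `|b| + 1).
have ab0 : 0 < `|a| + `|b| + 1 by rewrite ltr_wpDl// addr_ge0.
have h0 : 0 < h by rewrite !divr_gt0.
have Pst s t : 0 <= s <= h -> 0 <= t <= h -> P (p + s *: a + t *: b).
  move=> /andP[s0 sh] /andP[t0 th]; apply: dP; rewrite -ball_normE /ball_/=.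
  rewrite -addrA opprD addrA subrr sub0r normrN.
  apply: le_lt_trans (ler_normD _ _) _; rewrite !normrZ !ger0_norm//.
  apply: (@le_lt_trans _ _ (h * (`|a| + `|b|))).
    by rewrite mulrDr lerD// ler_wpM2r.
  apply: (@lt_le_trans _ _ (h * (`|a| + `|b| + 1))).
    by rewrite ltr_pM2l// ltrDl.
  rewrite /h divfK ?gt_eqF//; lra.
have [|s [t [sh th e1]]] := @second_difference _ f p a b h h0.
  move=> s t sh th; have [sf _ _] := Pst _ _ sh th.
  split; apply: smooth_near_differentiable => //; exact: smooth_near_derive.
have [|s' [t' [sh' th' e2]]] := @second_difference _ f p b a h h0.
  move=> s' t' sh' th'; rewrite addrAC; have [sf _ _] := Pst _ _ th' sh'.
  split; apply: smooth_near_differentiable => //; exact: smooth_near_derive.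
have : h * h * 'D_b ('D_a f) (p + s *: a + t *: b)
   = h * h * 'D_a ('D_b f) (p + s' *: b + t' *: a).
  rewrite -[LHS]e1 -[RHS]e2 [p + h *: b + _]addrAC.
  move: (f (p + _ + _)) (f (p + h *: a)) (f (p + h *: b)) (f p) => x y z w; ring.
have hh0 : h * h != 0 by rewrite mulf_neq0// gt_eqF.
move=> /(mulfI hh0) e; have [_ _ B1] := Pst _ _ sh th.
have [_ B2 _] := Pst _ _ th' sh'.
rewrite [p + _ + _]addrAC -e in B2.
rewrite [X in `|X|](_ : _ = ('D_a ('D_b f) p - 'D_b ('D_a f) (p + s *: a + t *: b))
  - ('D_b ('D_a f) p - 'D_b ('D_a f) (p + s *: a + t *: b))).
  apply: le_trans (ler_normB _ _) _.
  by apply: le_trans (lerD (ltW B2) (ltW B1)) _; rewrite -splitr.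
by rewrite opprB addrA subrK.
Unshelve. all: by end_near. Qed.

Lemma derive_coord E n (f : E -> 'rV[R]_n) x v i :
  differentiable f x -> ('D_v f x) 0 i = 'D_v (fun y => f y 0 i) x.
Proof. by move=> df; rewrite derive_mx ?mxE//; exact: diff_derivable. Qed.

Lemma smooth_near_coord E n (f : E -> 'rV[R]_n) x i :
  smooth_near f x -> smooth_near (fun y => f y 0 i : R) x.
Proof.
move=> fx; apply: (@smooth_near_comp _ _ _ f (fun v : 'rV[R]_n => v 0 i : R)) => //.
  exact: has_frame_row.
pose l (v : 'rV[R]_n) : R := v 0 i.
have ll : linear l by move=> a u v; rewrite /l !mxE.
pose L : {linear 'rV[R]_n -> R} := HB.pack l (GRing.isLinear.Build _ _ _ _ _ ll).
by apply: (@smooth_near_lin _ _ L); exact: coord_continuous.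
Qed.

Theorem derive_comm E n (f : E -> 'rV[R]_n) (p a b : E) :
  smooth_near f p -> 'D_a ('D_b f) p = 'D_b ('D_a f) p.
Proof.
move=> fp; apply/rowP => i.
have dn c : \forall q \near p, 'D_c (fun y => f y 0 i) q = 'D_c f q 0 i.
  near=> q; rewrite derive_coord//; apply: smooth_near_differentiable.
  by near: q; exact: near_smooth_near.
have d c : differentiable ('D_c f) p.
  by apply: smooth_near_differentiable; exact: smooth_near_derive.
have e c c' : ('D_c ('D_c' f) p) 0 i = 'D_c ('D_c' (fun y => f y 0 i)) p.
  by rewrite derive_coord//; apply/esym/near_eq_derive/dn.
transitivity ('D_a ('D_b (fun y => f y 0 i)) p); first exact: e.
transitivity ('D_b ('D_a (fun y => f y 0 i)) p); last by apply/esym; exact: e.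
exact/derive_comm_real/smooth_near_coord.
Unshelve. all: by end_near. Qed.

End smooth_near.

(** * Ordinary differential equations *)

Section row_norm.
Variables (R : realType) (n : nat).
Implicit Types v : 'rV[R]_n.

Lemma row_norm_le v (C : R) : 0 <= C -> (forall i, `|v 0 i| <= C) -> `|v| <= C.
Proof.
move=> C0 vC; rewrite [leLHS]/Num.Def.normr/= mx_normrE.
by apply: bigmax_le => // -[i j] _; rewrite (ord1 i); exact: vC.
Qed.

Lemma row_norm_coord v i : `|v 0 i| <= `|v|.
Proof.
rewrite [leRHS]/Num.Def.normr/= mx_normrE.
exact: (le_bigmax _ (fun ij : 'I_1 * 'I_n => `|v ij.1 ij.2|) (0, i)).
Qed.

End row_norm.

Section clamp.
Variable R : realType.

Definition clampR (c r x : R) : R := Num.max (c - r) (Num.min (c + r) x).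

Lemma clampR_dist (c r x : R) : 0 <= r -> `|clampR c r x - c| <= r.
Proof.
move=> r0; rewrite /clampR ler_distl; apply/andP; split.
  by rewrite le_max lexx.
by rewrite ge_max ge_min lexx/= andbT; lra.
Qed.

Lemma clampR_id (c r x : R) : `|x - c| <= r -> clampR c r x = x.
Proof.
rewrite ler_distl => /andP[x1 x2].
by rewrite /clampR (min_idPr x2) (max_idPr x1).
Qed.

Lemma clampR_lip (c r x y : R) : `|clampR c r x - clampR c r y| <= `|x - y|.
Proof.
rewrite /clampR.
set a := Num.min _ x; set b := Num.min _ y.
have ab : `|a - b| <= `|x - y|.
  rewrite /a /b; case: (ler0P (x - y)) => ?.
    by case: (leP (c + r) x) => ?; case: (leP (c + r) y) => ?; rewrite ler_norml; lra.
  by case: (leP (c + r) x) => ?; case: (leP (c + r) y) => ?; rewrite ler_norml; lra.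
apply: le_trans ab; case: (ler0P (a - b)) => ?.
  by case: (leP (c - r) a) => ?; case: (leP (c - r) b) => ?; rewrite ler_norml; lra.
by case: (leP (c - r) a) => ?; case: (leP (c - r) b) => ?; rewrite ler_norml; lra.
Qed.

(** The norm of ['rV[R]_n] is the sup norm, whose closed balls are boxes, so clamping each
    coordinate is a 1-Lipschitz retraction onto the closed ball. *)
Definition clamp_row n (c : 'rV[R]_n) (r : R) (v : 'rV[R]_n) : 'rV[R]_n :=
  \row_i clampR (c 0 i) r (v 0 i).

Lemma clamp_row_dist n (c : 'rV[R]_n) r v : 0 <= r -> `|clamp_row c r v - c| <= r.
Proof. by move=> r0; apply: row_norm_le => // i; rewrite !mxE clampR_dist. Qed.

Lemma clamp_row_id n (c : 'rV[R]_n) r v : `|v - c| <= r -> clamp_row c r v = v.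
Proof.
move=> vr; apply/rowP => i; rewrite mxE clampR_id//.
by apply: le_trans vr; have := row_norm_coord (v - c) i; rewrite !mxE.
Qed.

Lemma clamp_row_lip n (c : 'rV[R]_n) r u v :
  `|clamp_row c r u - clamp_row c r v| <= `|u - v|.
Proof.
apply: row_norm_le => // i; rewrite !mxE; apply: le_trans (clampR_lip _ _ _ _) _.
by have := row_norm_coord (u - v) i; rewrite !mxE.
Qed.

Lemma lip_continuous (V W : normedModType R) (f : V -> W) (K : R) :
  (forall x y, `|f x - f y| <= K * `|x - y|) -> continuous f.
Proof.
move=> H x; apply/cvgrPdist_lt => eps eps0.
have K0 : 0 < `|K| + 1 by rewrite ltr_wpDl.
near=> y; apply: le_lt_trans (H _ _) _.
apply: (@le_lt_trans _ _ ((`|K| + 1) * `|x - y|)).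
  by rewrite ler_wpM2r// (le_trans (ler_norm K))// lerDl.
rewrite -ltr_pdivlMl//; near: y.
have := @cvg_id _ (nbhs x) => /cvgrPdist_lt; apply.
by rewrite mulr_gt0// invr_gt0.
Unshelve. all: by end_near. Qed.

End clamp.

(** * Antiderivatives and the mean value inequality for row vectors *)

Section antiderivative.
Variable R : realType.

Lemma is_derive_rowP n (f : R -> 'rV[R]_n) (t : R) (v : 'rV[R]_n) :
  is_derive t 1 f v <-> forall i, is_derive t 1 (fun s => f s 0 i) (v 0 i).
Proof.
split=> [[d <-] i|H].
  split; first exact: (proj1 (derivable_mxP f t 1) d 0 i).
  by rewrite derive_mx// mxE.
have d : derivable f t 1.
  by apply/derivable_mxP => i j; rewrite (ord1 i); have [] := H j.
split=> //; rewrite derive_mx//; apply/rowP => i; rewrite mxE.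
by have [] := H i.
Qed.

(** Integrating from the left end [t0 - A] and subtracting the value at [t0] covers both sides of
    [t0] at once. *)
Lemma antiderivative (f : R -> R) (t0 A : R) : continuous f -> 0 < A ->
  exists2 g : R -> R, g t0 = 0 &
    forall t, `|t - t0| < A -> is_derive t 1 g (f t).
Proof.
move=> cf A0; pose a := t0 - A; pose u := t0 + A.
have fi : lebesgue_measure.-integrable `[a, u] (EFin \o f).
  apply: continuous_compact_integrable; first exact: segment_compact.
  exact: continuous_subspaceT.
pose F x := \int[lebesgue_measure]_(t in `[a, x]) f t.
exists (fun x => F x - F t0); first by rewrite subrr.
move=> t; rewrite ltr_distl => /andP[at_ tu].
have [d e] := continuous_FTC1_closed tu fi at_ (cf t).
have dF : is_derive t 1 F (f t) by apply: (DeriveDef d); rewrite -derive1E; exact: e.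
by have := is_deriveB dF (is_derive_cst (F t0) t 1); rewrite subr0.
Qed.

Lemma antiderivative_row n (f : R -> 'rV[R]_n) (t0 A : R) :
  continuous f -> 0 < A ->
  exists2 g : R -> 'rV[R]_n, g t0 = 0 &
    forall t, `|t - t0| < A -> is_derive t 1 g (f t).
Proof.
move=> cf A0; have H i : exists g : R -> R, g t0 = 0 /\
    forall t, `|t - t0| < A -> is_derive t 1 g (f t 0 i).
  have [|g g0 gf] := @antiderivative (fun t => f t 0 i) t0 A _ A0.
    move=> t; apply: (@continuous_comp _ _ _ f (fun v : 'rV[R]_n => v 0 i)).
      exact: cf.
    exact: coord_continuous.
  by exists g.
pose g i := projT1 (cid (H i)).
exists (fun t => \row_i g i t).
  by apply/rowP => i; rewrite !mxE; have [] := projT2 (cid (H i)).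
move=> t tA; apply/is_derive_rowP => i.
under eq_fun do rewrite mxE.
by have [_] := projT2 (cid (H i)); apply.
Qed.

(** The mean value theorem holds coordinate by coordinate, with a different point for each; the sup
    norm loses no constant. *)
Lemma mean_value_le n (g f : R -> 'rV[R]_n) (B a b : R) : a <= b -> 0 <= B ->
  (forall t, a <= t <= b -> is_derive t 1 g (f t)) ->
  (forall t, a <= t <= b -> `|f t| <= B) ->
  `|g b - g a| <= B * (b - a).
Proof.
move=> ab B0 dg fB; apply: row_norm_le; first by rewrite mulr_ge0// subr_ge0.
move=> i; rewrite !mxE.
have H t : a <= t <= b -> is_derive t 1 (fun s => g s 0 i) (f t 0 i).
  by move=> tab; apply/(is_derive_rowP _ _ _).1/dg.
have [||c] := @MVT_segment _ (fun s => g s 0 i) (fun s => f s 0 i) a b ab.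
- move=> t; rewrite in_itv/= => /andP[/ltW at_ /ltW tb].
  by apply: H; rewrite at_.
- apply: continuous_in_subspaceT => t; rewrite inE/= in_itv/= => tab.
  have [d _] := H t tab.
  by apply: differentiable_continuous; exact/derivable1_diffP.
rewrite in_itv/= => cab ->; rewrite normrM (ger0_norm (_ : 0 <= b - a)) ?subr_ge0//.
rewrite ler_wpM2r ?subr_ge0//.
by apply: le_trans (row_norm_coord _ _) _; exact: fB.
Qed.

Lemma mean_value_dist n (g f : R -> 'rV[R]_n) (B A t0 s t : R) : 0 <= B ->
  (forall t, `|t - t0| < A -> is_derive t 1 g (f t)) ->
  (forall t, `|f t| <= B) ->
  `|s - t0| < A -> `|t - t0| < A -> `|g s - g t| <= B * `|s - t|.
Proof.
move=> B0 dg fB; wlog ts : s t / t <= s.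
  move=> H sA tA; have [ts|/ltW st] := leP t s; first exact: H.
  by rewrite distrC [X in _ * X]distrC; exact: H.
rewrite !ltr_distl => sA tA; rewrite (ger0_norm (_ : 0 <= s - t)) ?subr_ge0//.
apply: mean_value_le => // u ut; apply: dg; rewrite ltr_distl; lra.
Qed.

End antiderivative.

(** * Picard iteration *)

Section picard.
Variable R : realType.

Lemma le0_geometric (x C : R) : (forall k, x <= C / 2 ^+ k) -> x <= 0.
Proof.
move=> H; rewrite leNgt; apply/negP => x0.
have z1 : `|2^-1 : R| < 1 by rewrite ger0_norm ?invr_ge0// invf_lt1// ltr1n.
have /cvgrPdist_lt/(_ _ x0)[k _ /(_ k (leqnn k))] := cvg_geometric C z1.
rewrite /= sub0r normrN exprVn => xk.
by have := le_lt_trans (le_trans (H k) (ler_norm _)) xk; rewrite ltxx.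
Qed.

Lemma geometric_cvg n (u : nat -> 'rV[R]_n) (C : R) :
  (forall k, `|u k.+1 - u k| <= C / 2 ^+ k) ->
  exists l, forall k, `|u k - l| <= C * 2 / 2 ^+ k.
Proof.
move=> H.
have p2 k : 0 < 2 ^+ k :> R by rewrite exprn_gt0.
have C0 : 0 <= C.
  by have := le_trans (normr_ge0 _) (H 0%N); rewrite expr0 divr1.
have T k p : `|u k - u (k + p)%N| <= C * 2 / 2 ^+ k.
  (* The partial geometric sum is kept exactly, since the weaker bound does not survive the
     induction on [p]. *)
  suff : `|u k - u (k + p)%N| <= C * 2 / 2 ^+ k - C * 2 / 2 ^+ (k + p).
    by move=> /le_trans; apply; rewrite gerBl divr_ge0// ?mulr_ge0// ltW.
  elim: p => [|p IH]; first by rewrite addn0 !subrr normr0.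
  rewrite -(subrKA (u (k + p)%N)); apply: le_trans (ler_normD _ _) _.
  have := H (k + p)%N; rewrite distrC addnS => h.
  have e : C * 2 / 2 ^+ (k + p).+1 = C / 2 ^+ (k + p).
    by rewrite exprS invfM mulrA mulfK.
  have e' : C * 2 / 2 ^+ (k + p) = C / 2 ^+ (k + p) + C / 2 ^+ (k + p).
    by rewrite mulr_natr mulrnAl mulr2n.
  apply: le_trans (lerD IH h) _; rewrite e e'; lra.
have cu : cauchy (u @ \oo).
  apply: cauchy_exP => eps eps0.
  have z1 : `|2^-1 : R| < 1 by rewrite ger0_norm ?invr_ge0// invf_lt1// ltr1n.
  have /cvgrPdist_lt/(_ _ eps0)[k _ /(_ k (leqnn k))] := cvg_geometric (C * 2) z1.
  rewrite /= sub0r normrN exprVn => xk.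
  exists (u k), k => //= m km; rewrite -ball_normE /ball_/=.
  rewrite -(subnKC km); apply: le_lt_trans (T _ _) _.
  exact: le_lt_trans (ler_norm _) xk.
have /cvg_ex[l ul] : cvg (u @ \oo) by exact: cauchy_cvg.
exists l => k; apply/ler_addgt0Pr => eps eps0.
have /cvgrPdist_lt/(_ _ eps0)[N _ uN] := ul.
have := uN _ (leq_addl k N); rewrite /= distrC => /ltW h.
by rewrite -(subrKA (u (k + N)%N)); apply: le_trans (ler_normD _ _) (lerD (T _ _) h).
Qed.

(* The field is clamped to the closed box where the bounds
   are known, so that all iterates are defined and continuous on the line. *)
Theorem picard n (F : R -> 'rV[R]_n -> 'rV[R]_n) (t0 : R) (e : 'rV[R]_n)
    (a r M K : R) :
  0 < a -> 0 < r ->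
  (forall s y, `|s - t0| <= a -> `|y - e| <= r ->
     {for (s, y), continuous (fun p : R * 'rV[R]_n => F p.1 p.2)}) ->
  (forall s y, `|s - t0| <= a -> `|y - e| <= r -> `|F s y| <= M) ->
  (forall s y z, `|s - t0| <= a -> `|y - e| <= r -> `|z - e| <= r ->
     `|F s y - F s z| <= K * `|y - z|) ->
  exists (d : R) (y : R -> 'rV[R]_n), [/\ 0 < d, y t0 = e &
    forall t, `|t - t0| < d -> [/\ `|t - t0| <= a, `|y t - e| <= r &
      is_derive t 1 y (F t (y t))]].
Proof.
move=> a0 r0 Fc FM FK.
have M0 : 0 <= M.
  by apply: le_trans (FM t0 e _ _) => //; rewrite subrr normr0 ltW.
pose K1 := `|K| + 1; have K10 : 0 < K1 by rewrite ltr_wpDl.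
pose M1 := M + 1; have M10 : 0 < M1 by rewrite ltr_wpDl.
(* The bound [a] keeps time where [F] is controlled, [r / M1] gives [M * d <= r] so that the
   solution stays in the box, and the last term makes each step a contraction by 1/2. [M1] and [K1]
   are shifted by 1 to be positive. *)
pose d := Num.min a (Num.min (r / M1) (1 / 2 / K1)).
have d0 : 0 < d by rewrite !lt_min a0 !divr_gt0.
have da : d <= a by rewrite ge_min lexx.
have dr : M * d <= r.
  apply: (@le_trans _ _ (M1 * d)); first by rewrite ler_pM2r// lerDl.
  by rewrite mulrC -ler_pdivlMr// !ge_min lexx !orbT.
have dK : K1 * d <= 1 / 2.
  by rewrite mulrC -ler_pdivlMr// !ge_min lexx !orbT.
pose G s y := F (clampR t0 a s) (clamp_row e r y).
have aG s : `|clampR t0 a s - t0| <= a by apply: clampR_dist; exact: ltW.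
have rG y : `|clamp_row e r y - e| <= r by apply: clamp_row_dist; exact: ltW.
have GM s y : `|G s y| <= M by exact: FM.
have GK s y z : `|G s y - G s z| <= K1 * `|y - z|.
  apply: le_trans (FK _ _ _ (aG _) (rG _) (rG _)) _.
  apply: (@le_trans _ _ (K1 * `|clamp_row e r y - clamp_row e r z|)).
    by rewrite ler_wpM2r// (le_trans (ler_norm K))// lerDl.
  by rewrite ler_pM2l// clamp_row_lip.
have Gc (z : R -> 'rV[R]_n) : continuous z -> continuous (fun s => G s (z s)).
  move=> cz s.
  apply: (@continuous_comp _ _ _ (fun s => (clampR t0 a s, clamp_row e r (z s)))
    (fun p : R * 'rV[R]_n => F p.1 p.2)); last exact: Fc.
  apply: (@cvg_pair _ _ _ _ (nbhs (clampR t0 a s)) (nbhs (clamp_row e r (z s)))).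
    apply: (@lip_continuous _ _ _ _ 1) => x y; rewrite mul1r; exact: clampR_lip.
  apply: (@continuous_comp _ _ _ z (clamp_row e r)); first exact: cz.
  by apply: (@lip_continuous _ _ _ _ 1) => x y; rewrite mul1r; exact: clamp_row_lip.
(* Antiderivatives are taken on a larger open interval, which contains the end points [t0 - d] and
   [t0 + d] that [tau] attains. *)
pose A := d + 1; have A0 : 0 < A by rewrite ltr_wpDl// ltW.
pose tau t := clampR t0 d t.
have taud t : `|tau t - t0| <= d by apply: clampR_dist; exact: ltW.
have tauA t : `|tau t - t0| < A by apply: le_lt_trans (taud t) _; rewrite ltrDl.
have tau0 : tau t0 = t0 by apply: clampR_id; rewrite subrr normr0 ltW.
(* A total choice of antiderivatives; its value is arbitrary when [z] is not continuous. *)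
have step (z : R -> 'rV[R]_n) : exists P : R -> 'rV[R]_n, continuous z ->
    P t0 = 0 /\ forall t, `|t - t0| < A -> is_derive t 1 P (G t (z t)).
  have [cz|] := pselect (continuous z); last by exists z.
  have [P P0 HP] := @antiderivative_row R n _ t0 A (Gc z cz) A0.
  by exists P.
pose P z := projT1 (cid (step z)).
have P0 z : continuous z -> P z t0 = 0.
  by move=> cz; have [] := projT2 (cid (step z)) cz.
have HP z t : continuous z -> `|t - t0| < A -> is_derive t 1 (P z) (G t (z t)).
  by move=> cz tA; have [_] := projT2 (cid (step z)) cz; apply.
(* The Picard operator, with time frozen outside the interval of radius [d]: its estimates thus hold
   uniformly on the whole line. *)
pose S z t := e + P z (tau t).
have Slip z s t : continuous z -> `|S z s - S z t| <= M * `|s - t|.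
  move=> cz; rewrite /S opprD addrACA subrr add0r.
  apply: le_trans (_ : _ <= M * `|tau s - tau t|) _; last first.
    by rewrite ler_wpM2l// clampR_lip.
  apply: (@mean_value_dist _ _ (P z) (fun t => G t (z t)) M A t0) => // u uA.
  exact: HP.
have Sc z : continuous z -> continuous (S z).
  by move=> cz; apply: (@lip_continuous _ _ _ _ M) => s t; exact: Slip.
have Sdist z w (B : R) : continuous z -> continuous w -> 0 <= B ->
    (forall t, `|z t - w t| <= B) -> forall t, `|S z t - S w t| <= B / 2.
  move=> cz cw B0 zw t; rewrite /S opprD addrACA subrr add0r.
  have := @mean_value_dist _ _ (fun t => P z t - P w t)
    (fun t => G t (z t) - G t (w t)) (K1 * B) A t0 (tau t) t0.
  rewrite (P0 z)// (P0 w)// !subr0 => /(_ _ _ _ (tauA t)); move=> h.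
  apply: (@le_trans _ _ (K1 * B * `|tau t - t0|)).
    apply: h => //.
    - by rewrite mulr_ge0// ltW.
    - by move=> u uA; apply: is_deriveB; exact: HP.
    - by move=> u; apply: le_trans (GK _ _ _) _; rewrite ler_pM2l.
    - by rewrite subrr normr0.
  apply: (@le_trans _ _ (K1 * B * d)); first by rewrite ler_wpM2l// mulr_ge0// ltW.
  by rewrite mulrAC -[B / 2]mulrC -[2^-1]mul1r ler_wpM2r.
pose z k := iter k S (fun=> e).
have zc k : continuous (z k).
  by elim: k => [|k IH]; [exact: cst_continuous|exact: Sc].
have zd k t : `|z k.+1 t - z k t| <= M * d / 2 ^+ k.
  elim: k t => [|k IH] t.
    rewrite expr0 divr1 /= {2}(_ : e = S (fun=> e) t0); last first.
      by rewrite /S tau0 P0 ?addr0//; exact: cst_continuous.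
    rewrite /S tau0 opprD addrACA subrr add0r.
    apply: (@le_trans _ _ (M * `|tau t - t0|)); last by rewrite ler_wpM2l.
    apply: (@mean_value_dist _ _ (P (fun=> e)) (fun t => G t e) M A t0) => //.
      by move=> u uA; apply: HP => //; exact: cst_continuous.
    by rewrite subrr normr0.
  have Md0 : 0 <= M * d / 2 ^+ k by rewrite divr_ge0 ?mulr_ge0 ?exprn_ge0// ltW.
  have := Sdist _ _ _ (zc k.+1) (zc k) Md0 IH t.
  by rewrite exprSr invfM mulrA.
have zl t : exists l, forall k, `|z k t - l| <= M * d * 2 / 2 ^+ k.
  by apply: (@geometric_cvg n (fun k => z k t) (M * d)) => k; exact: zd.
pose y t := projT1 (cid (zl t)).
have zy t k : `|z k t - y t| <= M * d * 2 / 2 ^+ k by exact: (projT2 (cid (zl t)) k).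
have Mz k s t : `|z k s - z k t| <= M * `|s - t|.
  case: k => [|k]; first by rewrite /= subrr normr0 mulr_ge0.
  exact: Slip.
(* All iterates share the Lipschitz constant [M], which passes to their pointwise limit. *)
have yc : continuous y.
  apply: (@lip_continuous _ _ _ _ M) => s t; rewrite -subr_le0.
  apply: (@le0_geometric _ (M * d * 2 * 2)) => k; rewrite lerBlDr.
  have e1 : y s - y t = (z k s - z k t) + (z k t - y t) - (z k s - y s).
    by rewrite subrKA opprB [RHS]addrC subrKA.
  rewrite e1; apply: le_trans (ler_normB _ _) _.
  apply: le_trans (lerD (ler_normD _ _) (lexx _)) _.
  have := Mz k s t; have := zy t k; have := zy s k.
  rewrite mulrAC -!mulrA; lra.
have yS t : y t = S y t.
  apply/eqP; rewrite -subr_eq0 -normr_le0.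
  apply: (@le0_geometric _ (M * d * 2)) => k.
  have B0 : 0 <= M * d * 2 / 2 ^+ k by rewrite divr_ge0 ?mulr_ge0 ?exprn_ge0// ltW.
  have h := Sdist _ _ _ (zc k) yc B0 (zy^~ k) t.
  have := zy t k.+1; rewrite exprSr invfM mulrA -/(z k.+1) => h'.
  have -> : y t - S y t = (S (z k) t - S y t) - (z k.+1 t - y t).
    by rewrite /= opprB [RHS]addrC subrKA.
  apply: le_trans (ler_normB _ _) _; lra.
exists d, y; split=> //; first by rewrite yS /S tau0 P0// addr0.
move=> t td.
have ye u : `|y u - e| <= r.
  rewrite yS [X in _ - X](_ : e = S y t0); last by rewrite /S tau0 P0// addr0.
  rewrite /S tau0 opprD addrACA subrr add0r.
  apply: le_trans dr; apply: (@le_trans _ _ (M * `|tau u - t0|)).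
    apply: (@mean_value_dist _ _ (P y) (fun t => G t (y t)) M A t0) => //.
      by move=> v vA; exact: HP.
    by rewrite subrr normr0.
  by rewrite ler_wpM2l.
have ta : `|t - t0| <= a by apply: le_trans (ltW td) da.
split=> //.
have -> : F t (y t) = G t (y t) by rewrite /G clampR_id// clamp_row_id.
have tA : `|t - t0| < A by apply: lt_trans td _; rewrite ltrDl.
(* Since [|t - t0| < d] is strict, [tau] is the identity near [t] and the fixed point equation reads
   [y = e + P y] there. *)
apply: (@near_eq_is_derive _ _ _ (fun s => e + P y s)).
  near=> s; rewrite [in RHS]yS /S /tau clampR_id//; apply: ltW; near: s.
  have : {for t, continuous (fun s => `|s - t0|)}.
    apply: continuous_comp; last exact: norm_continuous.
    by apply: continuousB; [exact: cvg_id|exact: cst_continuous].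
  by move=> /cvgr_lt; apply.
by have := is_deriveD (is_derive_cst e t 1) (HP _ _ yc tA); rewrite add0r.
Unshelve. all: by end_near. Qed.

End picard.

(** * The group law in a chart *)

Section partial_derivatives.
Variable R : realType.
Implicit Types E F G : normedModType R.

(** The two difference quotients are the same function of the increment, so their limits coincide,
    existing or not. *)
Lemma derive_partial2 E F G (f : E * F -> G) (y : E) (z v : F) :
  'D_v (fun z' => f (y, z')) z = 'D_(0, v) f (y, z).
Proof.
rewrite /derive; set g := (X in lim (X @ _)); set g' := (X in _ = lim (X @ _)).
suff -> : g = g' by [].
apply/funext => h; rewrite /g /g' /=.
suff -> : h *: (0, v) + (y, z) = (y, h *: v + z) by [].
by congr (_, _); rewrite /= scaler0 add0r.
Qed.

Lemma derive_partial1 E F G (f : E * F -> G) (y u : E) (z : F) :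
  'D_u (fun y' => f (y', z)) y = 'D_(u, 0) f (y, z).
Proof.
rewrite /derive; set g := (X in lim (X @ _)); set g' := (X in _ = lim (X @ _)).
suff -> : g = g' by [].
apply/funext => h; rewrite /g /g' /=.
suff -> : h *: (u, 0) + (y, z) = (h *: u + y, z) by [].
by congr (_, _); rewrite /= scaler0 add0r.
Qed.

Lemma smooth_near_partial1 E F G (f : E * F -> G) (y : E) (z : F) :
  has_frame E -> has_frame F ->
  smooth_near f (y, z) -> smooth_near (fun y' => f (y', z)) y.
Proof.
move=> hE hF fyz; apply: (@smooth_near_comp _ _ _ _ (fun y' => (y', z)) f) => //.
  exact: has_frame_prod.
by apply: smooth_near_pair; [exact: smooth_near_id|exact: smooth_near_cst].
Qed.

Lemma smooth_near_partial2 E F G (f : E * F -> G) (y : E) (z : F) :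
  has_frame E -> has_frame F ->
  smooth_near f (y, z) -> smooth_near (fun z' => f (y, z')) z.
Proof.
move=> hE hF fyz; apply: (@smooth_near_comp _ _ _ _ (fun z' => (y, z')) f) => //.
  exact: has_frame_prod.
by apply: smooth_near_pair; [exact: smooth_near_cst|exact: smooth_near_id].
Qed.

Lemma derive_scale E F (a : E -> R) (f : E -> F) x v :
  differentiable a x -> differentiable f x ->
  'D_v (fun y => a y *: f y) x = a x *: 'D_v f x + 'D_v a x *: f x.
Proof.
move=> da df; have [d e] := is_diff_scale da df.
by rewrite deriveE// e !deriveE.
Qed.

Lemma derive_bigsum E F n (f : 'I_n -> E -> F) x v :
  (forall i, differentiable (f i) x) ->
  'D_v (fun y => \sum_(i < n) f i y) x = \sum_(i < n) 'D_v (f i) x.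
Proof.
move=> df; rewrite -derive_sum => [|i]; last exact: diff_derivable.
by congr ('D_v _ x); apply/funext => y; rewrite fct_sumE.
Qed.

Lemma derive_comp E F G (f : E -> F) (g : F -> G) x v :
  differentiable f x -> differentiable g (f x) ->
  'D_v (fun y => g (f y)) x = 'D_('D_v f x) g (f x).
Proof.
move=> df dg; rewrite (@deriveE _ _ _ (g \o f)); last exact: differentiable_comp.
by rewrite diff_comp//= !deriveE.
Qed.

Lemma derive_row_sum n F (f : 'rV[R]_n -> F) x (v : 'rV[R]_n) :
  differentiable f x ->
  'D_v f x = \sum_(i < n) v 0 i *: 'D_(delta_mx 0 i) f x.
Proof.
move=> df; rewrite deriveE// {1}(row_sum_delta v) linear_sum.
by apply: eq_bigr => i _; rewrite linearZ deriveE.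
Qed.

Lemma near_pair2 (T U : topologicalType) (P : T * U -> Prop) (x : T) (y : U) :
  (\forall p \near (x, y), P p) ->
  \forall x' \near x, \forall y' \near y, P (x', y').
Proof.
move=> [[A B] /= [Ax By] AB].
apply: filterS Ax => x' Ax'; apply: filterS By => y' By'.
exact: (AB (x', y')).
Qed.

End partial_derivatives.

(** * The differential of Ad at 1 is the bracket: computation in coordinates *)

Section local_adjoint.
Variables (R : realType) (n : nat).
Local Notation E := 'rV[R]_n.
Variables (m C : E * E -> E) (e : E).
Hypotheses (m_smooth : smooth_near m (e, e)) (C_smooth : smooth_near C (e, e)).
Hypotheses (m1r : \forall y \near e, m (y, e) = y)
  (C1l : \forall z \near e, C (e, z) = z)
  (C1r : \forall y \near e, C (y, e) = e)
  (mC : \forall p \near (e, e), m (C p, p.1) = m p).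

Let hE : has_frame E := has_frame_row R n.
Let hEE : has_frame (E * E)%type := has_frame_prod hE hE.

(** With [m] the product and [C] the map (y, z) -> y z y^-1 in a chart, [L v] is the left-invariant
    field with value [v] at [e], and [A v y] is Ad_y v. *)
Let L (v y : E) : E := 'D_v (fun z => m (y, z)) e.
Let A (v y : E) : E := 'D_v (fun z => C (y, z)) e.

Lemma smooth_near_conjugation v : smooth_near (A v) e.
Proof.
have -> : A v = (fun y => 'D_(0, v) C (y, e)).
  by apply/funext => y; exact: derive_partial2.
apply: (@smooth_near_partial1 _ _ _ _ ('D_(0, v) C)) => //.
exact: smooth_near_derive.
Qed.

(* Differentiate m(C(y, z), y) = m(y, z) in z, then in y, at (e, e). *)
Lemma derive_conjugation u v :
  'D_u (A v) e = 'D_u (L v) e - 'D_v (L u) e.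
Proof.
(* The right-invariant field whose value at [e] is the i-th basis vector. *)
pose B i y : E := 'D_(delta_mx 0 i, 0) m (e, y).
have CeE : C (e, e) = e by exact: nbhs_singleton C1r.
have mS := near_pair2 (near_smooth_near m_smooth).
have m2 : \forall y \near e, smooth_near m (e, y) by exact: nbhs_singleton mS.
have m1 : \forall y \near e, smooth_near m (y, e).
  by apply: filterS mS => y; exact: nbhs_singleton.
have C1 : \forall y \near e, smooth_near C (y, e).
  apply: filterS (near_pair2 (near_smooth_near C_smooth)) => y.
  exact: nbhs_singleton.
(* The derivative in z at [e] of m(C(y, z), y) = m(y, z): a left-invariant field is expanded in
   right-invariant ones, with the coordinates of Ad_y v as coefficients. *)
have E1 : \forall y \near e, \sum_(i < n) (A v y) 0 i *: B i y = L v y.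
  near=> y.
  have my : smooth_near m (y, e) by near: y.
  have ym : smooth_near m (e, y) by near: y.
  have Cy : smooth_near C (y, e) by near: y.
  have Cye : C (y, e) = e by near: y; exact: C1r.
  have dC : differentiable (fun z => C (y, z)) e.
    exact/smooth_near_differentiable/smooth_near_partial2.
  have dm : differentiable (fun x => m (x, y)) e.
    exact/smooth_near_differentiable/smooth_near_partial1.
  have -> : L v y = 'D_v (fun z => m (C (y, z), y)) e.
    apply: near_eq_derive; apply: filterS (_ : \forall z \near e, m (C (y, z), y) = m (y, z)).
      by move=> z ->.
    by near: y; exact: (near_pair2 mC).
  have dm' : differentiable (fun x => m (x, y)) (C (y, e)) by rewrite Cye.
  rewrite (derive_comp v dC dm') Cye.
  rewrite (derive_row_sum _ dm); apply: eq_bigr => i _; congr (_ *: _).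
  by rewrite derive_partial1.
have dA i : differentiable (fun y => (A v y) 0 i : R) e.
  apply: smooth_near_differentiable; apply: smooth_near_coord.
  exact: smooth_near_conjugation.
have sB i : smooth_near (B i) e.
  apply: (@smooth_near_partial2 _ _ _ _ ('D_(delta_mx 0 i, 0) m)) => //.
  exact: smooth_near_derive.
have dB i : differentiable (B i) e by exact: smooth_near_differentiable.
have BE i : B i e = delta_mx 0 i.
  rewrite /B -derive_partial1 -[RHS](derive_id e).
  exact: near_eq_derive.
have AE : A v e = v.
  rewrite -[RHS](derive_id e v); exact: near_eq_derive.
(* The product rule at [e], where [A v e = v] and [B i e] is a basis vector, gives ['D_u (A v) e]
   plus a sum of derivatives of the [B i]. *)
rewrite -(near_eq_derive u E1) derive_bigsum; last first.
  by move=> i; have [] := is_diff_scale (dA i) (dB i).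
have -> : \sum_(i < n) 'D_u (fun y => (A v y) 0 i *: B i y) e =
    \sum_(i < n) (v 0 i *: 'D_u (B i) e + ('D_u (A v) e) 0 i *: delta_mx 0 i).
  apply: eq_bigr => i _; rewrite derive_scale// AE BE derive_coord//.
  exact/smooth_near_differentiable/smooth_near_conjugation.
rewrite big_split /= -row_sum_delta addrC -addrA.
(* Both sides are the mixed second derivative of [m] at (e, e) in the directions (v, 0) and (0, u),
   taken in opposite orders. *)
have -> : 'D_v (L u) e = \sum_(i < n) v 0 i *: 'D_u (B i) e.
  have -> : L u = (fun y => 'D_(0, u) m (y, e)).
    by apply/funext => y; exact: derive_partial2.
  have sm : smooth_near ('D_(0, u) m) (e, e) by exact: smooth_near_derive.
  have dL : differentiable (fun y => 'D_(0, u) m (y, e)) e.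
    exact/smooth_near_differentiable/(smooth_near_partial1 hE hE sm).
  have h0 := derive_row_sum v dL.
  have h1 i := derive_partial1 ('D_(0, u) m) e (delta_mx 0 i) e.
  have h2 i := derive_comm (delta_mx 0 i, 0) (0, u) m_smooth.
  have h3 i := derive_partial2 ('D_(delta_mx 0 i, 0) m) e e u.
  rewrite h0.
  apply: eq_bigr => i _.
  rewrite h1.
  rewrite h2.
  by rewrite -h3.
by rewrite subrr addr0.
Unshelve. all: by end_near. Qed.

End local_adjoint.

(** * Charts around a point *)

Section charts.
Variable R : realType.

(* What is used of a chart c of a manifold at a point x; stable under products. *)
Definition chart_at (M : topologicalType) (E : normedModType R)
    (c : chart M E) (x : M) : Prop :=
  [/\ forall z, dom c z -> bwd c (fwd c z) = z,
      nbhs x (dom c),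
      {for x, continuous (fwd c)},
      {for fwd c x, continuous (bwd c)} &
      nbhs (fwd c x) (fwd c @` dom c)].

Lemma is_chart_at (M : topologicalType) (E : normedModType R)
    (c : chart M E) (x : M) : is_chart c -> dom c x -> chart_at c x.
Proof.
move=> [od oi cf cb K] dx; split=> //.
- exact: open_nbhs_nbhs.
- by move: cf; rewrite continuous_open_subspace// => /(_ x); apply; rewrite inE.
- move: cb; rewrite continuous_open_subspace// => /(_ (fwd c x)); apply.
  by rewrite inE; exists x.
- by apply: open_nbhs_nbhs; split=> //; exists x.
Qed.

Lemma chart_at_prod (M N : topologicalType) (E F : normedModType R)
    (c : chart M E) (d : chart N F) x y :
  chart_at c x -> chart_at d y -> chart_at (prod_chart c d) (x, y).
Proof.
move=> [cK cx cf cb cn] [dK dy df db dn]; split=> /=.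
- by move=> [u v] [/= cu dv]; rewrite cK// dK.
- by exists (dom c, dom d).
- apply: (@cvg_pair _ _ _ _ (nbhs (fwd c x)) (nbhs (fwd d y))).
    exact: (cvg_comp fst (fwd c) cvg_fst cf).
  exact: (cvg_comp snd (fwd d) cvg_snd df).
- apply: (@cvg_pair _ _ _ _ (nbhs (bwd c (fwd c x))) (nbhs (bwd d (fwd d y)))).
    exact: (cvg_comp fst (bwd c) cvg_fst cb).
  exact: (cvg_comp snd (bwd d) cvg_snd db).
- exists (fwd c @` dom c, fwd d @` dom d) => // -[a b] [/= [u cu <-] [v dv <-]].
  by exists (u, v).
Qed.

Lemma near_bwd (M : topologicalType) (E : normedModType R) (c : chart M E) x
    (P : M -> Prop) : chart_at c x ->
  (\forall z \near x, P z) -> \forall y \near fwd c x, P (bwd c y).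
Proof.
move=> [K cx _ cb _] xP; apply: cb.
by rewrite K//; exact: nbhs_singleton.
Qed.

Lemma near_fwdK (M : topologicalType) (E : normedModType R) (c : chart M E) x :
  chart_at c x -> \forall y \near fwd c x, fwd c (bwd c y) = y.
Proof.
move=> [K cx _ cb cn]; apply: filterS cn => _ [z dz <-].
by rewrite K.
Qed.

Lemma bwd_fwd (M : topologicalType) (E : normedModType R) (c : chart M E) x :
  chart_at c x -> bwd c (fwd c x) = x.
Proof. by move=> [K cx _ _ _]; apply: K; exact: nbhs_singleton. Qed.

Lemma smooth_map_near (M N : topologicalType) (E F : normedModType R)
    (A : set (chart M E)) (B : set (chart N F)) (f : M -> N) c d x :
  smooth_map A B setT f -> A c -> B d -> chart_at c x -> nbhs (f x) (dom d) ->
  smooth_near (fun y => fwd d (f (bwd c y))) (fwd c x).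
Proof.
move=> [fc fs] Ac Bd cx dfx; apply: smooth_near_nbhs (fs _ _ Ac Bd).
have [K dx _ _ cn] := cx.
have fd : \forall y \near fwd c x, dom d (f (bwd c y)).
  by apply: (near_bwd (P := fun z => dom d (f z)) cx); exact: (fc x I _ dfx).
have dc := near_bwd cx dx.
have fK := near_fwdK cx.
near=> y; exists (bwd c y); last by near: y.
split; first split=> //.
  by near: y.
by rewrite /=; near: y.
Unshelve. all: by end_near. Qed.

End charts.

(** * Group identities, translations, conjugation and Ad in a chart *)

Section lie_group.
Variables (R : realType) (H : lieGroup R).
Local Notation E := 'rV[R]_(lg_dim H).
Local Notation "1" := (@lg_one R H).
Local Notation "x * y" := (@lg_mul R H x y).
Local Notation "x ^-1" := (@lg_inv R H x).
Implicit Types x k : H.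

Lemma lg_mulKV x y : x^-1 * (x * y) = y.
Proof. by rewrite lg_mulA lg_mulV lg_mul1. Qed.

Lemma lg_mulVr x : x * x^-1 = 1.
Proof. by rewrite -[LHS](lg_mulKV x^-1) (lg_mulKV x) lg_mulV. Qed.

Lemma lg_mulr1 x : x * 1 = x.
Proof. by rewrite -(lg_mulV x) lg_mulA lg_mulVr lg_mul1. Qed.

Lemma lg_mulVK x y : x * (x^-1 * y) = y.
Proof. by rewrite lg_mulA lg_mulVr lg_mul1. Qed.

Lemma lg_mulI x y z : x * y = x * z -> y = z.
Proof. by move=> e; rewrite -(lg_mulKV x y) e lg_mulKV. Qed.

Lemma lg_invK x : x^-1^-1 = x.
Proof. by apply: (@lg_mulI x^-1); rewrite lg_mulVr lg_mulV. Qed.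

Lemma lg_inv1 : 1^-1 = 1.
Proof. by rewrite -[LHS]lg_mul1 lg_mulVr. Qed.

Lemma lg_invM x y : (x * y)^-1 = y^-1 * x^-1.
Proof.
apply: (@lg_mulI (x * y)).
by rewrite lg_mulVr -lg_mulA lg_mulVK lg_mulVr.
Qed.

Lemma lg_mul_continuous x y :
  {for (x, y), continuous (fun p : H * H => p.1 * p.2)}.
Proof. by have [cm _] := lg_mul_smooth H; exact: cm. Qed.

Lemma lg_inv_continuous : continuous (@lg_inv R H).
Proof. by move=> x; have [cm _] := lg_inv_smooth H; exact: cm. Qed.

Lemma lg_mul_cvg (T : Type) (F : set_system T) {FF : Filter F} (f g : T -> H) x y :
  f @ F --> x -> g @ F --> y -> (fun t => f t * g t) @ F --> x * y.
Proof.
move=> fx gy; apply: (@cvg_comp _ _ _ (fun t => (f t, g t)) (fun p : H * H => p.1 * p.2)).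
  exact: (cvg_pair fx gy).
exact: lg_mul_continuous.
Qed.

Lemma atlas_chart_at (c : chart H E) x : lg_atlas c -> dom c x -> chart_at c x.
Proof. by move=> Ac; apply: is_chart_at; have [ch _ _] := lg_is_atlas H; exact: ch. Qed.

Lemma atlas_nbhs (c : chart H E) x : lg_atlas c -> dom c x -> nbhs x (dom c).
Proof. by move=> Ac dx; have [] := atlas_chart_at Ac dx. Qed.

Lemma exists_chart x : exists2 c : chart H E, lg_atlas c & dom c x.
Proof. by have [_ ex _] := lg_is_atlas H; exact: ex. Qed.

(** All pairs of charts are allowed, so that a composition may pass through any chart around the
    intermediate point. *)
Definition smooth_at (f : H -> H) x : Prop :=
  {for x, continuous f} /\
  forall c d : chart H E, lg_atlas c -> lg_atlas d -> dom c x -> dom d (f x) ->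
    smooth_near (fun y => fwd d (f (bwd c y))) (fwd c x).

Lemma smooth_at_comp (f g : H -> H) x :
  smooth_at f x -> smooth_at g (f x) -> smooth_at (fun z => g (f z)) x.
Proof.
move=> [fc fs] [gc gs]; split; first exact: (continuous_comp fc gc).
move=> c d Ac Ad cx dx; have [b Ab bx] := exists_chart (f x).
have chc := atlas_chart_at Ac cx; have chb := atlas_chart_at Ab bx.
apply: (@smooth_near_eq _ _ _ (fun y => fwd d (g (bwd b (fwd b (f (bwd c y))))))).
  have : \forall z \near x, dom b (f z) by apply: fc; exact: atlas_nbhs.
  by move=> /(near_bwd chc); apply: filterS => y dy; have [-> // _ _ _ _] := chb.
apply: (@smooth_near_comp _ _ _ _ (fun y => fwd b (f (bwd c y)))
  (fun y => fwd d (g (bwd b y)))).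
- exact: has_frame_row.
- exact: fs.
- by rewrite (bwd_fwd chc); exact: gs.
Qed.

Lemma smooth_near_mul (c c' d : chart H E) x y :
  lg_atlas c -> lg_atlas c' -> lg_atlas d -> dom c x -> dom c' y ->
  dom d (x * y) ->
  smooth_near (fun p : E * E => fwd d (bwd c p.1 * bwd c' p.2))
    (fwd c x, fwd c' y).
Proof.
move=> Ac Ac' Ad cx cy dxy.
apply: (smooth_map_near (lg_mul_smooth H) (c := prod_chart c c') (x := (x, y))) => //.
- by exists c, c'.
- by apply: chart_at_prod; exact: atlas_chart_at.
- exact: atlas_nbhs.
Qed.

Lemma smooth_at_mull k x : smooth_at (fun z => k * z) x.
Proof.
split.
  by apply: lg_mul_cvg; [exact: cvg_cst|exact: cvg_id].
move=> c d Ac Ad cx dx; have [b Ab bk] := exists_chart k.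
have := smooth_near_mul Ab Ac Ad bk cx dx.
move=> /(smooth_near_partial2 (has_frame_row _ _) (has_frame_row _ _)).
by rewrite /= (bwd_fwd (atlas_chart_at Ab bk)).
Qed.

Lemma smooth_at_mulr k x : smooth_at (fun z => z * k) x.
Proof.
split.
  by apply: lg_mul_cvg; [exact: cvg_id|exact: cvg_cst].
move=> c d Ac Ad cx dx; have [b Ab bk] := exists_chart k.
have := smooth_near_mul Ac Ab Ad cx bk dx.
move=> /(smooth_near_partial1 (has_frame_row _ _) (has_frame_row _ _)).
by rewrite /= (bwd_fwd (atlas_chart_at Ab bk)).
Qed.

Lemma smooth_at_inv x : smooth_at (@lg_inv R H) x.
Proof.
split; first exact: lg_inv_continuous.
move=> c d Ac Ad cx dx; apply: (smooth_map_near (lg_inv_smooth H)) => //.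
  exact: atlas_chart_at.
exact: atlas_nbhs.
Qed.

Lemma smooth_at_conj k x : smooth_at (fun z => k * z * k^-1) x.
Proof.
by apply: (@smooth_at_comp (fun z => k * z) (fun z => z * k^-1));
  [exact: smooth_at_mull|exact: smooth_at_mulr].
Qed.

Variable c : chart H E.
Hypotheses (Ac : lg_atlas c) (c1 : dom c 1).
Let e : E := fwd c 1.

Let c_at : chart_at c 1 := atlas_chart_at Ac c1.
Let be : bwd c e = 1 := bwd_fwd c_at.

Lemma near_chart_one (P : H -> Prop) :
  (\forall z \near 1, P z) -> \forall y \near e, P (bwd c y).
Proof. exact: near_bwd. Qed.

(** [Ad] on the tangent space at 1 read in [c]: [Ad i k x] is by definition [int_inv i] of
    [chart_Ad] at [int_iso i x]. *)
Definition chart_Ad k (v : E) : E :=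
  'D_v (fun z => fwd c (k * bwd c z * k^-1)) e.

Lemma smooth_near_conj k : smooth_near (fun z => fwd c (k * bwd c z * k^-1)) e.
Proof.
have [_] := smooth_at_conj k 1; apply=> //.
by rewrite lg_mulr1 lg_mulVr.
Qed.

Lemma chart_Ad_linear k : linear (chart_Ad k).
Proof.
have d := smooth_near_differentiable (smooth_near_conj k).
by move=> a u v; rewrite /chart_Ad !deriveE// linearP.
Qed.

Lemma chart_Ad1 v : chart_Ad 1 v = v.
Proof.
rewrite /chart_Ad -[RHS](derive_id e v); apply: near_eq_derive.
apply: filterS (near_fwdK c_at) => z zK.
by rewrite lg_inv1 lg_mulr1 lg_mul1.
Qed.

(** Chain rule at [e], a fixed point of every conjugation; by continuity, conjugation by [k'] stays
    in [dom c] near 1, where the intermediate passage through the chart cancels. *)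
Lemma chart_AdM k k' v : chart_Ad (k * k') v = chart_Ad k (chart_Ad k' v).
Proof.
have d k0 := smooth_near_differentiable (smooth_near_conj k0).
have e1 : fwd c (k' * bwd c e * k'^-1) = e by rewrite be lg_mulr1 lg_mulVr.
have dk : differentiable (fun z => fwd c (k * bwd c z * k^-1))
  ((fun z => fwd c (k' * bwd c z * k'^-1)) e) by rewrite e1; exact: d.
have := derive_comp v (d k') dk; rewrite /= e1 => h.
rewrite {2}/chart_Ad {2}/chart_Ad -h; apply: near_eq_derive.
have : \forall z \near 1, dom c (k' * z * k'^-1).
  have [fc _] := smooth_at_conj k' 1; apply: fc; apply: atlas_nbhs => //.
  by rewrite lg_mulr1 lg_mulVr.
move=> /near_chart_one; apply: filterS => z dz.
by have [-> // _ _ _ _] := c_at; rewrite lg_invM !lg_mulA.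
Qed.

End lie_group.

(** * Smooth differential equations: regularity and local existence *)

Section ode.
Variable R : realType.

Lemma derive_real_dir (V : normedModType R) (y : R -> V) (s v : R) :
  differentiable y s -> 'D_v y s = v *: 'D_1 y s.
Proof.
move=> dy; rewrite !deriveE// -linearZ; congr ('d y s _).
by rewrite /GRing.scale/= mulr1.
Qed.

(** Bootstrap: if [y] is of class C^k, so is its derivative [F (s, y s)], hence [y] is of class
    C^(k+1). The open set [U] is fixed before the induction. *)
Lemma ode_smooth n (F : R * 'rV[R]_n -> 'rV[R]_n) (y : R -> 'rV[R]_n) (t : R) :
  smooth_near F (t, y t) ->
  (\forall s \near t, is_derive (s : R) 1 y (F (s, y s))) ->
  smooth_near y t.
Proof.
move=> [V [oV Vt FV]] dy.
have yc (s : R) : is_derive s 1 y (F (s, y s)) -> {for s, continuous y}.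
  by move=> [d _]; apply: differentiable_continuous; exact/derivable1_diffP.
have yV : \forall s \near t, V (s, y s).
  have c : {for t, continuous (fun s => (s, y s))}.
    by exact: (cvg_pair (@cvg_id _ (nbhs t)) (yc _ (nbhs_singleton dy))).
  by apply: c; exact: open_nbhs_nbhs.
have : nbhs t [set s : R | is_derive s 1 y (F (s, y s)) /\ V (s, y s)].
  by apply: filterS2 dy yV => s.
rewrite nbhsE => -[U [oU Ut] UH]; exists U; split=> //; elim=> [|k IH].
  by move=> s /UH[/yc].
have dfy s : U s -> differentiable y s.
  by move=> /UH[[d _] _]; exact/derivable1_diffP.
split=> // v; apply: (@Ck_near _ _ _ _ _ (fun s => v *: F (s, y s))) => //.
  by move=> s Us; have [[d <-] _] := UH s Us; rewrite (derive_real_dir v (dfy s Us)).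
apply: Ck_scale => //; first exact: Ck_cst.
apply: (@Ck_comp _ _ _ _ _ _ V (fun s => (s, y s)) F) => //.
- by apply: has_frame_prod; [exact: has_frame_R|exact: has_frame_row].
- by move=> s /UH[].
- apply: Ck_pair => //.
  by apply: (@Ck_lin _ _ _ _ _ [the {linear R -> R} of idfun]) => x; exact: cvg_id.
Qed.

Lemma picard_smooth n (F : R * 'rV[R]_n -> 'rV[R]_n) (t0 : R) (e : 'rV[R]_n) :
  smooth_near F (t0, e) ->
  exists2 y : R -> 'rV[R]_n, y t0 = e &
    \forall t \near t0, is_derive (t : R) 1 y (F (t, y t)).
Proof.
move=> sF.
have hRE : has_frame (R * 'rV[R]_n)%type.
  by apply: has_frame_prod; [exact: has_frame_R|exact: has_frame_row].
have bdd (G : R * 'rV[R]_n -> 'rV[R]_n) : smooth_near G (t0, e) ->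
    \forall p \near (t0, e), `|G p| <= `|G (t0, e)| + 1.
  move=> /smooth_near_continuous /cvgrPdist_lt/(_ 1 ltr01).
  apply: filterS => p h; rewrite -[G p](subrK (G (t0, e))) [leRHS]addrC.
  by apply: le_trans (ler_normD _ _) _; rewrite lerD2r distrC ltW.
pose D i := 'D_(0, delta_mx 0 i) F : R * 'rV[R]_n -> 'rV[R]_n.
pose B i := `|D i (t0, e)| + 1.
have N1 := near_smooth_near sF; have N2 := bdd F sF.
have N3i i : \forall p \near (t0, e), `|D i p| <= B i.
  exact/(bdd (D i))/smooth_near_derive.
have N3 : \forall p \near (t0, e), forall i, `|D i p| <= B i.
  exact: filter_forall N3i.
have : \forall p \near (t0, e), [/\ smooth_near F p, `|F p| <= `|F (t0, e)| + 1
    & forall i, `|D i p| <= B i].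
  by apply: filterS3 N1 N2 N3 => p; split.
move=> /nbhs_ballP[r /= r0 rP].
have r20 : 0 < r / 2 by rewrite divr_gt0.
have P s y : `|s - t0| <= r / 2 -> `|y - e| <= r / 2 ->
    [/\ smooth_near F (s, y), `|F (s, y)| <= `|F (t0, e)| + 1
    & forall i, `|D i (s, y)| <= B i].
  move=> sr yr; apply: rP; split=> /=; rewrite -ball_normE /ball_/= distrC.
    by apply: le_lt_trans sr _; lra.
  by apply: le_lt_trans yr _; lra.
have Bi0 i : 0 <= B i by rewrite addr_ge0.
(* A Lipschitz constant in the space variable: along a segment, the derivative in direction [y - z]
   is the sum of the [D i] weighted by the coordinates of [y - z], each at most [|y - z|]. *)
pose K := \sum_i B i.
have [|||d [y [d0 yt0 Hy]]] := @picard R n (fun s y => F (s, y)) t0 e (r / 2) (r / 2)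
    (`|F (t0, e)| + 1) K r20 r20.
- move=> s y sr yr; have [sFs _ _] := P s y sr yr.
  have -> : (fun p : R * 'rV[R]_n => F (p.1, p.2)) = F.
    by apply/funext => -[].
  exact: smooth_near_continuous.
- by move=> s y sr yr; have [] := P s y sr yr.
- move=> s y z sr yr zr.
  pose w (th : R) := z + th *: (y - z).
  have wr th : 0 <= th <= 1 -> `|w th - e| <= r / 2.
    move=> /andP[th0 th1].
    have -> : w th - e = th *: (y - e) + (1 - th) *: (z - e).
      rewrite /w !scalerBr !scalerBl !scale1r; apply/rowP => i; rewrite !mxE; ring.
    apply: le_trans (ler_normD _ _) _; rewrite !normrZ !ger0_norm ?subr_ge0//.
    have h1 := ler_wpM2l th0 yr.
    have h2 : (1 - th) * `|z - e| <= (1 - th) * (r / 2).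
      by apply: ler_wpM2l => //; rewrite subr_ge0.
    by apply: le_trans (lerD h1 h2) _; rewrite -mulrDl addrC subrK mul1r.
  have := @mean_value_le R n (fun th => F (s, w th))
    (fun th => 'D_(0, y - z) F (s, w th)) (K * `|y - z|) 0 1 ler01.
  rewrite subr0 mulr1 /w scale1r scale0r addr0 [z + _]addrC subrK; apply.
  + by rewrite mulr_ge0// sumr_ge0.
  + move=> th th01; have [sFs _ _] := P _ _ sr (wr _ th01).
    apply: (@is_derive_comp_curve _ _ _ F (fun th => (s, w th))); last first.
      exact: smooth_near_differentiable.
    exact: is_derive_pair (is_derive_cst s th 1) (is_derive_line z (y - z) th).
  + move=> th th01; have [sFs _ DB] := P _ _ sr (wr _ th01).
    have dF := smooth_near_differentiable (smooth_near_partial2 (has_frame_R R) (has_frame_row R n) sFs).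
    rewrite -derive_partial2 (derive_row_sum _ dF).
    apply: le_trans (ler_norm_sum _ _ _) _; rewrite mulr_suml.
    apply: ler_sum => i _; rewrite normrZ mulrC derive_partial2.
    by apply: ler_pM => //; [exact: DB|exact: row_norm_coord].
exists y => //; apply/nbhs_ballP; exists d => //= t; rewrite -ball_normE /ball_/= distrC.
by move=> /Hy[].
Qed.

End ode.

(** [P] and its negation both cut out open subsets of the connected set [J]. *)
Lemma connected_locally_const (R : realType) (J : set R) (P : R -> Prop) q :
  open J -> is_interval J -> (forall t, J t -> \forall s \near t, P s <-> P t) ->
  J q -> P q -> forall t, J t -> P t.
Proof.
move=> oJ /connected_intervalP cJ H Jq Pq.
have op (Q : R -> Prop) : (forall t, J t -> \forall s \near t, Q s <-> Q t) ->
    open [set t | J t /\ Q t].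
  move=> HQ; rewrite openE => t [Jt Qt]; have := HQ t Jt.
  have : nbhs t J by exact: open_nbhs_nbhs.
  by apply: filterS2 => s Js [_ h]; split=> //; exact: h.
have oN : open [set t | J t /\ ~ P t].
  apply: op => t Jt; apply: filterS (H t Jt) => s [h1 h2].
  by split=> nP p; apply: nP; [exact: h2|exact: h1].
have E : [set t | J t /\ P t] = J.
  apply: cJ; first by exists q.
    exists [set t | J t /\ P t]; first exact: op.
    by apply/seteqP; split=> t /=; tauto.
  exists (~` [set t | J t /\ ~ P t]); first exact: open_closedC.
  apply/seteqP; split=> t /= [Jt h]; split=> //; first by move=> [].
  by apply: contrapT => nP; exact: h.
by move=> t; rewrite -{1}E => -[].
Qed.

(** * Logarithmic derivatives of curves in the group *)

Section log_derivative.
Variables (R : realType) (H : lieGroup R).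
Local Notation E := 'rV[R]_(lg_dim H).
Local Notation "1" := (@lg_one R H) : lg_scope.
Local Notation "x * y" := (@lg_mul R H x y) : lg_scope.
Local Notation "x ^-1" := (@lg_inv R H x) : lg_scope.
Delimit Scope lg_scope with lg.
Variable c : chart H E.
Hypotheses (Ac : lg_atlas c) (c1 : dom c (@lg_one R H)).
Let e : E := fwd c (@lg_one R H).
Let c_at : chart_at c (@lg_one R H) := atlas_chart_at Ac c1.
Let be : bwd c e = (@lg_one R H) := bwd_fwd c_at.
Let cK z : dom c z -> bwd c (fwd c z) = z.
Proof. by have [K _ _ _ _] := c_at; exact: K. Qed.
Let hE : has_frame E := has_frame_row R _.

Let nc1 : nbhs (@lg_one R H) (dom c) := atlas_nbhs Ac c1.

Let near_e (P : H -> Prop) :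
  (\forall z \near (@lg_one R H), P z) -> \forall y \near e, P (bwd c y).
Proof. exact: near_bwd. Qed.

Let near_ee (P : H * H -> Prop) :
  (\forall z \near ((@lg_one R H), (@lg_one R H)), P z) ->
  \forall p \near (e, e), P (bwd c p.1, bwd c p.2).
Proof. exact: (near_bwd (chart_at_prod c_at c_at)). Qed.

Let m (p : E * E) : E := fwd c (bwd c p.1 * bwd c p.2)%lg.
Let C (p : E * E) : E := fwd c (bwd c p.1 * bwd c p.2 * (bwd c p.1)^-1)%lg.

Lemma smooth_near_inv1 : smooth_near (fun y => fwd c (bwd c y)^-1%lg) e.
Proof.
by have [_] := smooth_at_inv (@lg_one R H); apply=> //; rewrite lg_inv1.
Qed.

Lemma smooth_near_mul1 : smooth_near m (e, e).
Proof. by apply: smooth_near_mul => //; rewrite lg_mul1. Qed.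

Lemma near_mul_dom :
  \forall p \near (e, e), dom c (bwd c p.1 * bwd c p.2)%lg.
Proof.
apply: (near_ee (P := fun z => dom c (z.1 * z.2)%lg)).
by apply: (lg_mul_continuous (x := (@lg_one R H)) (y := (@lg_one R H))); rewrite /= lg_mul1.
Qed.

Lemma near_inv_dom : \forall y \near e, dom c (bwd c y)^-1%lg.
Proof.
apply: (near_e (P := fun z => dom c z^-1%lg)).
by apply: lg_inv_continuous; rewrite lg_inv1.
Qed.

Lemma near_fst (P : E -> Prop) :
  (\forall y \near e, P y) -> \forall p \near (e, e), P p.1.
Proof. by move=> He; exact: (@cvg_fst _ _ (nbhs e) (nbhs e) _ _ He). Qed.

Lemma near_snd (P : E -> Prop) :
  (\forall y \near e, P y) -> \forall p \near (e, e), P p.2.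
Proof. by move=> He; exact: (@cvg_snd _ _ (nbhs e) (nbhs e) _ _ He). Qed.

Lemma smooth_near_fst : smooth_near (fun p : E * E => p.1) (e, e).
Proof.
exact: (@smooth_near_lin _ _ _ (@fst E E) (e, e) (fun p => cvg_fst)).
Qed.

Lemma smooth_near_snd : smooth_near (fun p : E * E => p.2) (e, e).
Proof.
exact: (@smooth_near_lin _ _ _ (@snd E E) (e, e) (fun p => cvg_snd)).
Qed.

(** Near (e, e), [C] is the product of m(y, z) and y^-1, with passages through the chart
    inserted. *)
Lemma smooth_near_conj2 : smooth_near C (e, e).
Proof.
apply: (@smooth_near_eq _ _ _ (fun p => m (m p, fwd c (bwd c p.1)^-1%lg))).
  apply: filterS2 near_mul_dom (near_fst near_inv_dom) => p d1 d2.
  by rewrite {1}/m /= !cK.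
have hEE := has_frame_prod hE hE.
apply: (@smooth_near_comp _ _ _ _ (fun p => (m p, fwd c (bwd c p.1)^-1%lg)) m) => //.
  apply: smooth_near_pair; first exact: smooth_near_mul1.
  apply: (@smooth_near_comp _ _ _ _ (fun p : E * E => p.1) (fun y => fwd c (bwd c y)^-1%lg)) => //.
    exact: smooth_near_fst.
  exact: smooth_near_inv1.
have me : m (e, e) = e by rewrite /m /= !be lg_mul1.
have ie : fwd c (bwd c e)^-1%lg = e by rewrite be lg_inv1.
by rewrite /= me ie; exact: smooth_near_mul1.
Qed.

Lemma near_conj_dom :
  \forall p \near (e, e), dom c (bwd c p.1 * bwd c p.2 * (bwd c p.1)^-1)%lg.
Proof.
apply: (near_ee (P := fun z => dom c (z.1 * z.2 * z.1^-1)%lg)).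
have := @lg_mul_cvg _ _ _ (nbhs ((@lg_one R H), (@lg_one R H))) _
  (fun z => z.1 * z.2)%lg (fun z => z.1^-1)%lg _ _
  (@lg_mul_continuous _ _ (@lg_one R H) (@lg_one R H))
  (cvg_comp fst (@lg_inv R H) cvg_fst (@lg_inv_continuous _ _ (@lg_one R H))).
by apply; rewrite /= lg_inv1 !lg_mul1.
Qed.

Lemma derive_chart_Ad u v :
  'D_u (fun y => chart_Ad c (bwd c y) v) e = tangent_br c u v.
Proof.
apply: (@derive_conjugation _ _ m C e smooth_near_mul1 smooth_near_conj2).
- apply: filterS (near_fwdK c_at) => y yK.
  by rewrite /m /= be lg_mulr1.
- apply: filterS (near_fwdK c_at) => y yK.
  by rewrite /C /= be lg_mul1 lg_inv1 lg_mulr1.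
- by near=> y; rewrite /C /= be lg_mulr1 lg_mulVr.
- apply: filterS near_conj_dom => p dp.
  by rewrite /m /C /= cK// -lg_mulA lg_mulV lg_mulr1.
Unshelve. all: by end_near. Qed.

Lemma smooth_near_chart_Ad v : smooth_near (fun y => chart_Ad c (bwd c y) v) e.
Proof. exact: (smooth_near_conjugation smooth_near_conj2). Qed.

Lemma is_derive_scale_curve (V : normedModType R) (a : R -> R) (f : R -> V) (t a' : R) (f' : V) :
  is_derive t 1 a a' -> is_derive t 1 f f' ->
  is_derive t 1 (fun s => a s *: f s) (a t *: f' + a' *: f t).
Proof.
move=> [/derivable1_diffP da <-] [/derivable1_diffP df <-].
have [d _] := is_diff_scale da df.
by apply: DeriveDef; [exact/derivable1_diffP|rewrite derive_scale].
Qed.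

(** Ad is known to be smooth in the group variable on fixed vectors. Expanding [w s] in the standard
    basis gives products of a scalar curve and such a curve; at [t], where [y t = e], Ad is the
    identity. *)
Lemma is_derive_chart_Ad (y w : R -> E) (t : R) (u w' : E) :
  y t = e -> is_derive t 1 y u -> is_derive t 1 w w' ->
  is_derive t 1 (fun s => chart_Ad c (bwd c (y s)) (w s)) (tangent_br c u (w t) + w').
Proof.
move=> yt dy dw.
have Ad_sum k v : chart_Ad c k v = \sum_i v 0 i *: chart_Ad c k (delta_mx 0 i).
  pose L : {linear E -> E} := HB.pack (chart_Ad c k)
    (GRing.isLinear.Build _ _ _ _ _ (chart_Ad_linear Ac c1 k)).
  have -> : chart_Ad c k v = L v by [].
  rewrite {1}(row_sum_delta v) linear_sum.
  by apply: eq_bigr => i _; rewrite linearZ.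
have da i : differentiable (fun z => chart_Ad c (bwd c z) (delta_mx 0 i)) e.
  exact/smooth_near_differentiable/smooth_near_chart_Ad.
have d i : is_derive t 1 (fun s => w s 0 i *: chart_Ad c (bwd c (y s)) (delta_mx 0 i))
    (w t 0 i *: 'D_u (fun z => chart_Ad c (bwd c z) (delta_mx 0 i)) e
     + w' 0 i *: delta_mx 0 i).
  have d1 := (is_derive_rowP w t w').1 dw i.
  have d2 : is_derive t 1 (fun s => chart_Ad c (bwd c (y s)) (delta_mx 0 i))
      ('D_u (fun z => chart_Ad c (bwd c z) (delta_mx 0 i)) e).
    rewrite -yt; apply: (@is_derive_comp_curve _ _ _ (fun z => chart_Ad c (bwd c z) (delta_mx 0 i)) y) => //.
    by rewrite yt.
  have := is_derive_scale_curve d1 d2.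
  by rewrite yt be chart_Ad1.
have -> : (fun s => chart_Ad c (bwd c (y s)) (w s)) =
    \sum_i (fun s => w s 0 i *: chart_Ad c (bwd c (y s)) (delta_mx 0 i)).
  by apply/funext => s; rewrite Ad_sum fct_sumE.
have -> : tangent_br c u (w t) + w' =
  \sum_i (w t 0 i *: 'D_u (fun z => chart_Ad c (bwd c z) (delta_mx 0 i)) e
     + w' 0 i *: delta_mx 0 i).
  rewrite big_split /= -row_sum_delta; congr (_ + _).
  rewrite -derive_chart_Ad.
  have -> : (fun z => chart_Ad c (bwd c z) (w t)) =
      (fun z => \sum_i w t 0 i *: chart_Ad c (bwd c z) (delta_mx 0 i)).
    by apply/funext => z; exact: Ad_sum.
  rewrite derive_bigsum => [|i]; last exact: (differentiableZ (w t 0 i) (da i)).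
  apply: eq_bigr => i _.
  have := @deriveZ _ _ _ (fun z => chart_Ad c (bwd c z) (delta_mx 0 i)) (w t 0 i) e u.
  by apply; exact: diff_derivable.
exact: is_derive_sum.
Qed.

(** Continuity is part of the notion because [fwd c] is arbitrary off [dom c]: it ensures that
    j(t)^-1 j stays in the chart near [t], so that the derivative carries information on [j]. *)
Definition logder (j : R -> H) (t : R) (v : E) : Prop :=
  {for t, continuous j} /\
  is_derive t 1 (fun s => fwd c ((j t)^-1 * j s)%lg) v.

Lemma logder_mull j (t : R) v k : logder j t v -> logder (fun s => k * j s)%lg t v.
Proof.
move=> [cj dj]; split.
  by apply: lg_mul_cvg => //; exact: cvg_cst.
suff -> : (fun s => fwd c ((k * j t)^-1 * (k * j s))%lg) =
  (fun s => fwd c ((j t)^-1 * j s)%lg) by [].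
by apply/funext => s; rewrite lg_invM -lg_mulA lg_mulKV.
Qed.

Lemma logder_near j j' (t : R) v :
  (\forall s \near t, j s = j' s) -> logder j t v -> logder j' t v.
Proof.
move=> jj' [cj dj]; have ejt : j t = j' t by exact: nbhs_singleton jj'.
split.
  change (j' @ t --> j' t); rewrite -ejt; apply: cvg_trans cj.
  by apply: near_eq_cvg; apply: filterS jj' => s.
apply: (near_eq_is_derive _ dj); apply: filterS jj' => s ->.
by rewrite ejt.
Qed.

Lemma near_translate (j : R -> H) (t : R) : {for t, continuous j} ->
  \forall s \near t, dom c ((j t)^-1 * j s)%lg.
Proof.
move=> cj; have : (fun s => (j t)^-1 * j s)%lg @ t --> ((j t)^-1 * j t)%lg.
  by apply: lg_mul_cvg => //; exact: cvg_cst.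
by rewrite lg_mulV; apply.
Qed.

Lemma smooth_near_mull_e g : dom c g ->
  smooth_near (fun z => fwd c (g * bwd c z)%lg) e.
Proof. by move=> cg; have [_] := smooth_at_mull g (@lg_one R H); apply=> //; rewrite lg_mulr1. Qed.

(** Near [t], g^-1 j(s) is g^-1 j(t) times j(t)^-1 j(s), and the differential at 1 of a left
    translation produces the left-invariant field. The condition on [j] thus becomes an ordinary
    differential equation in the chart translated by [g]. *)
Lemma logder_chart j (t : R) v g : logder j t v -> dom c (g^-1 * j t)%lg ->
  is_derive t 1 (fun s => fwd c (g^-1 * j s)%lg)
    (left_inv_field c v (fwd c (g^-1 * j t)%lg)).
Proof.
move=> [cj dj] cg; have sm := smooth_near_mull_e cg.
have e1 : fwd c ((j t)^-1 * j t)%lg = e by rewrite lg_mulV.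
have := @is_derive_comp_curve _ _ _ (fun z => fwd c (g^-1 * j t * bwd c z)%lg)
  (fun s => fwd c ((j t)^-1 * j s)%lg) t v dj.
rewrite e1 => /(_ (smooth_near_differentiable sm)).
rewrite /left_inv_field cK//; apply: near_eq_is_derive.
apply: filterS (near_translate cj) => s ds.
by rewrite cK// -lg_mulA lg_mulVK.
Qed.

(** The differential of translation by z^-1 undoes that of translation by z, so it sends the
    left-invariant vector at z back to [v]. *)
Lemma logder_of_chart (y : R -> E) (t : R) v g : (exists2 z, dom c z & y t = fwd c z) ->
  is_derive t 1 y (left_inv_field c v (y t)) ->
  logder (fun s => g * bwd c (y s))%lg t v.
Proof.
move=> [z dz ytz] dy.
have cz := atlas_chart_at Ac dz.
have byt : bwd c (y t) = z by rewrite ytz cK.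
have cby : {for t, continuous (fun s => bwd c (y s))}.
  apply: (@continuous_comp _ _ _ y (bwd c)); last first.
    by rewrite ytz; have [_ _ _ h _] := cz.
  by have [d _] := dy; apply: differentiable_continuous; exact/derivable1_diffP.
apply: logder_mull; split=> //.
rewrite byt.
have sN : smooth_near (fun x => fwd c (z^-1 * bwd c x)%lg) (y t).
  rewrite ytz; have [_] := smooth_at_mull z^-1%lg z; apply=> //.
  by rewrite lg_mulV.
have dN := smooth_near_differentiable sN.
have := is_derive_comp_curve dy dN.
rewrite /left_inv_field byt -[fwd c (@lg_one R H)]/e.
have sm := smooth_near_mull_e dz.
have dm := smooth_near_differentiable sm.
have e1 : (fun z0 => fwd c (z * bwd c z0)%lg) e = y t by rewrite /= be lg_mulr1.
have dN' : differentiable (fun x => fwd c (z^-1 * bwd c x)%lg)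
   ((fun z0 => fwd c (z * bwd c z0)%lg) e) by rewrite e1.
have := derive_comp v dm dN'; rewrite e1 => <-.
suff -> : 'D_v (fun y0 => fwd c (z^-1 * bwd c (fwd c (z * bwd c y0)))%lg) e = v by [].
rewrite -[RHS](derive_id e v); apply: near_eq_derive.
have h : \forall x \near (@lg_one R H), dom c (z * x)%lg.
  have [cm _] := smooth_at_mull z (@lg_one R H).
  by apply: cm; rewrite lg_mulr1; exact: atlas_nbhs.
apply: filterS2 (near_e h) (near_fwdK c_at) => x dx xK.
by rewrite cK// lg_mulKV.
Qed.

End log_derivative.

(** * Curves with given logarithmic derivative *)

Section development.
Variables (R : realType) (H : lieGroup R).
Local Notation E := 'rV[R]_(lg_dim H).
Local Notation "1" := (@lg_one R H) : lg_scope.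
Local Notation "x * y" := (@lg_mul R H x y) : lg_scope.
Local Notation "x ^-1" := (@lg_inv R H x) : lg_scope.
Delimit Scope lg_scope with lg.
Variable c : chart H E.
Hypotheses (Ac : lg_atlas c) (c1 : dom c (@lg_one R H)).
Let e : E := fwd c (@lg_one R H).
Let c_at : chart_at c (@lg_one R H) := atlas_chart_at Ac c1.
Let be : bwd c e = (@lg_one R H) := bwd_fwd c_at.
Let cK z : dom c z -> bwd c (fwd c z) = z.
Proof. by have [K _ _ _ _] := c_at; exact: K. Qed.
Let hE : has_frame E := has_frame_row R _.
Let hEE : has_frame (E * E)%type := has_frame_prod hE hE.

(* y z^-1 is constant on the diagonal, so its differential vanishes there. *)
Lemma logder_div (j1 j2 : R -> H) (t : R) (v : E) :
  logder c j1 t v -> logder c j2 t v -> logder c (fun s => j1 s * (j2 s)^-1)%lg t 0.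
Proof.
move=> [cj1 dj1] [cj2 dj2]; split.
  apply: lg_mul_cvg => //.
  exact: (@continuous_comp _ _ _ j2 (@lg_inv R H) t cj2 (@lg_inv_continuous _ _ _)).
pose q (p : E * E) : E := fwd c (bwd c p.1 * (bwd c p.2)^-1)%lg.
have iE : fwd c (bwd c e)^-1%lg = e by rewrite be lg_inv1.
have sq : smooth_near q (e, e).
  apply: (@smooth_near_eq _ _ _ (fun p => fwd c (bwd c p.1 * bwd c (fwd c (bwd c p.2)^-1))%lg)).
    apply: filterS (near_snd (near_inv_dom Ac c1)) => p dp.
    by rewrite /q cK.
  apply: (@smooth_near_comp _ _ _ _ (fun p : E * E => (p.1, fwd c (bwd c p.2)^-1%lg))
    (fun p => fwd c (bwd c p.1 * bwd c p.2)%lg)) => //.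
    apply: smooth_near_pair; first exact: smooth_near_fst.
    apply: (@smooth_near_comp _ _ _ _ (fun p : E * E => p.2) (fun y => fwd c (bwd c y)^-1%lg)) => //.
      exact: smooth_near_snd.
    exact: smooth_near_inv1.
  rewrite /= iE; exact: smooth_near_mul1.
(* For k = j1 j2^-1, the curve k(t)^-1 k(s) is g a(s) b(s)^-1 g^-1, with a and b the translates of
   j1 and j2 to 1: a conjugation applied to a curve of zero velocity at [t]. *)
pose g := j2 t.
pose a s := fwd c ((j1 t)^-1 * j1 s)%lg; pose b s := fwd c ((j2 t)^-1 * j2 s)%lg.
have at_ : a t = e by rewrite /a lg_mulV.
have bt : b t = e by rewrite /b lg_mulV.
have dab : is_derive t 1 (fun s => (a s, b s)) (v, v).
  exact: is_derive_pair dj1 dj2.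
have dq := smooth_near_differentiable sq.
have q0 : 'D_(v, v) q (e, e) = 0.
  have did : differentiable (fun y : E => (y, y)) e.
    by apply: smooth_near_differentiable; apply: smooth_near_pair; exact: smooth_near_id.
  have did' := smooth_near_differentiable (smooth_near_id e).
  have := derive_comp v did dq; rewrite (derive_pair v did' did') derive_id => <-.
  have -> : (fun y : E => q (y, y)) = (fun=> e).
    by apply/funext => y; rewrite /q /= lg_mulVr.
  exact: derive_cst.
have dqab : is_derive t 1 (fun s => q (a s, b s)) 0.
  rewrite -q0.
  have := @is_derive_comp_curve _ _ _ q (fun s => (a s, b s)) t (v, v) dab.
  by rewrite at_ bt; apply.
have sg := smooth_near_conj Ac c1 g.
have qe : q (a t, b t) = e by rewrite at_ bt /q /= lg_mulVr.
have := @is_derive_comp_curve _ _ _ (fun z => fwd c (g * bwd c z * g^-1)%lg)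
  (fun s => q (a s, b s)) t 0 dqab.
rewrite qe derive0 => /(_ (smooth_near_differentiable sg)).
apply: near_eq_is_derive.
have da := near_translate Ac c1 cj1; have db := near_translate Ac c1 cj2.
have dd : \forall s \near t, dom c ((j1 t)^-1 * j1 s * ((j2 t)^-1 * j2 s)^-1)%lg.
  have : (fun s => (j1 t)^-1 * j1 s * ((j2 t)^-1 * j2 s)^-1)%lg @ t -->
     ((j1 t)^-1 * j1 t * ((j2 t)^-1 * j2 t)^-1)%lg.
    apply: lg_mul_cvg; first by apply: lg_mul_cvg => //; exact: cvg_cst.
    apply: (cvg_comp (fun s => ((j2 t)^-1 * j2 s)%lg) (@lg_inv R H)); last exact: lg_inv_continuous.
    by apply: lg_mul_cvg => //; exact: cvg_cst.
  by rewrite !lg_mulV lg_inv1 lg_mul1; apply; exact: atlas_nbhs.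
near=> s.
have as_ : dom c ((j1 t)^-1 * j1 s)%lg by near: s.
have bs : dom c ((j2 t)^-1 * j2 s)%lg by near: s.
have ds : dom c ((j1 t)^-1 * j1 s * ((j2 t)^-1 * j2 s)^-1)%lg by near: s.
rewrite /q /= /a /b !cK// /g; congr (fwd c _).
by rewrite !lg_invM !lg_invK !lg_mulA -[X in X = _]lg_mulA lg_mulVr lg_mulr1.
Unshelve. all: by end_near. Qed.

(** The left-invariant field of the zero vector vanishes, so k(t)^-1 k has zero derivative in the
    chart around [t]. *)
Lemma logder0_locally_const (k : R -> H) (t : R) :
  (\forall s \near t, logder c k s 0) -> \forall s \near t, k s = k t.
Proof.
move=> lk; have [ck _] := nbhs_singleton lk.
have N := near_translate Ac c1 ck.
have : \forall s \near t, logder c k s 0 /\ dom c ((k t)^-1 * k s)%lg.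
  by apply: filterS2 lk N => s.
move=> /nbhs_ballP[d /= d0 dP].
pose y s := fwd c ((k t)^-1 * k s)%lg.
have dy (s : R) : `|s - t| < d -> is_derive s 1 y 0.
  move=> sd; have [|ls ds] := dP s; first by rewrite -ball_normE /ball_/= distrC.
  have := logder_chart Ac c1 ls ds.
  by rewrite /left_inv_field derive0.
apply/nbhs_ballP; exists d => //= s sd.
have [_ ds] := dP s sd.
rewrite -ball_normE /ball_/= distrC in sd.
have : `|y s - y t| <= 0 * `|s - t|.
  apply: (@mean_value_dist R _ y (fun=> 0) 0 d t s t (lexx _) dy) => // [u|].
    by rewrite normr0.
  by rewrite subrr normr0.
rewrite mul0r normr_le0 subr_eq0 => /eqP yst.
have : ((k t)^-1 * k s)%lg = (@lg_one R H).
  rewrite -(cK ds) -[fwd c _]/(y s) yst /y lg_mulV -[fwd c _]/e be//.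
by rewrite -[in X in X -> _](lg_mulV (k t)) => /lg_mulI.
Qed.

(** The quotient j1 j2^-1 is locally constant, so being equal to 1 is a locally constant property on
    the interval [J]. *)
Lemma logder_unique (xi : R -> E) (J : set R) (j1 j2 : R -> H) q :
  open J -> is_interval J -> J q -> j1 q = j2 q ->
  (forall t, J t -> logder c j1 t (xi t)) ->
  (forall t, J t -> logder c j2 t (xi t)) -> forall t, J t -> j1 t = j2 t.
Proof.
move=> oJ iJ Jq eq l1 l2.
pose k s := (j1 s * (j2 s)^-1)%lg.
have E1 s : k s = (@lg_one R H) <-> j1 s = j2 s.
  split=> [|es]; last by rewrite /k es lg_mulVr.
  rewrite /k => es; rewrite -[LHS]lg_mulr1 -(lg_mulV (j2 s)) lg_mulA es.
  by rewrite lg_mul1.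
have H0 : forall t, J t -> k t = (@lg_one R H).
  apply: (connected_locally_const oJ iJ (q := q)) => //; last exact/E1.
  move=> t Jt; have : \forall s \near t, logder c k s 0.
    have : nbhs t J by exact: open_nbhs_nbhs.
    by apply: filterS => s Js; apply: logder_div (l1 _ Js) (l2 _ Js).
  by move=> /logder0_locally_const; apply: filterS => s ->.
by move=> t /H0 /E1.
Qed.

(** Local existence requires joint smoothness in time and position; it is visible once [xi] is
    expanded in the standard basis. *)
Lemma smooth_near_left_inv_field (xi : R -> E) (t : R) : smooth_near xi t ->
  smooth_near (fun p : R * E => left_inv_field c (xi p.1) p.2) (t, e).
Proof.
move=> sxi; pose m (p : E * E) : E := fwd c (bwd c p.1 * bwd c p.2)%lg.
have sm : smooth_near m (e, e) by exact: smooth_near_mul1.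
have hRE : has_frame (R * E)%type by apply: has_frame_prod => //; exact: has_frame_R.
apply: (@smooth_near_eq _ _ _ (fun p : R * E =>
    \sum_i xi p.1 0 i *: 'D_(0, delta_mx 0 i) m (p.2, e))).
  have N : \forall y \near e, smooth_near m (y, e).
    have mS := near_pair2 (near_smooth_near sm).
    by apply: filterS mS => y; exact: nbhs_singleton.
  have N2 : \forall p \near (t, e), smooth_near m (p.2, e).
    exact: (@cvg_snd _ _ (nbhs t) (nbhs e) _ _ N).
  apply: filterS N2 => p sp.
  have := smooth_near_differentiable (smooth_near_partial2 hE hE sp).
  have -> : left_inv_field c (xi p.1) p.2 = 'D_(xi p.1) (fun z => m (p.2, z)) e by [].
  move=> /derive_row_sum ->; apply: eq_bigr => i _.
  by rewrite derive_partial2.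
have s2 : smooth_near (fun p : R * E => p.2) (t, e).
  exact: (@smooth_near_lin _ _ _ (@snd R E) (t, e) (fun p => cvg_snd)).
have s1 : smooth_near (fun p : R * E => p.1) (t, e).
  exact: (@smooth_near_lin _ _ _ (@fst R E) (t, e) (fun p => cvg_fst)).
have st i : smooth_near (fun p : R * E => xi p.1 0 i *: 'D_(0, delta_mx 0 i) m (p.2, e)) (t, e).
  apply: smooth_near_scale.
    apply: smooth_near_coord.
    apply: (@smooth_near_comp _ _ _ _ (fun p : R * E => p.1) xi) => //.
    exact: has_frame_R.
  apply: (@smooth_near_comp _ _ _ _ (fun p : R * E => (p.2, e)) ('D_(0, delta_mx 0 i) m)) => //.
    by apply: smooth_near_pair => //; exact: smooth_near_cst.
  exact: smooth_near_derive.
elim: (index_enum _) => [|i r IH].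
  under eq_fun do rewrite big_nil; exact: smooth_near_cst.
under eq_fun do rewrite big_cons.
exact: smooth_near_add.
Qed.

Lemma logder_local_exists (xi : R -> E) (t : R) : smooth_near xi t ->
  exists2 j : R -> H, j t = (@lg_one R H) & \forall s \near t, logder c j s (xi s).
Proof.
move=> /smooth_near_left_inv_field /picard_smooth[y yt dy].
(* The factor 1 is the [g] of [logder_of_chart]. *)
exists (fun s => (@lg_one R H) * bwd c (y s))%lg; first by rewrite yt be lg_mul1.
have yc : {for t, continuous y}.
  have [d _] := nbhs_singleton dy.
  by apply: differentiable_continuous; exact/derivable1_diffP.
have N : \forall s \near t, exists2 z, dom c z & y s = fwd c z.
  have [_ _ _ _ cn] := c_at; rewrite -[fwd c _]/e -yt in cn.
  have yn : nbhs t (y @^-1` (fwd c @` dom c)) by exact: (yc _ cn).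
  by apply: filterS yn => s [z dz zs]; exists z.
by apply: filterS2 N dy => s Ns ds; exact: logder_of_chart.
Qed.

Lemma logder_global_exists (xi : R -> E) (I : set R) (t0 : R) :
  open I -> is_interval I -> I t0 -> (forall t, I t -> smooth_near xi t) ->
  exists2 j : R -> H, j t0 = (@lg_one R H) & forall t, I t -> logder c j t (xi t).
Proof.
move=> oI iI It0 sxi.
pose sol (J : set R) (j : R -> H) := [/\ open J, is_interval J &
   forall s, J s -> logder c j s (xi s)].
have int_open (J K : set R) : open J /\ is_interval J -> open K /\ is_interval K ->
    open (J `&` K) /\ is_interval (J `&` K).
  move=> [oJ iJ] [oK iK]; split; first exact: openI.
  move=> x y [Jx Kx] [Jy Ky] z xzy; split; first exact: (iJ x y).
  exact: (iK x y).
have sol_unique J j K k q : sol J j -> sol K k -> J q -> K q -> j q = k q ->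
    forall s, J s -> K s -> j s = k s.
  move=> [oJ iJ lj] [oK iK lk] Jq Kq eq s Js Ks.
  have [oJK iJK] := int_open _ _ (conj oJ iJ) (conj oK iK).
  apply: (logder_unique (q := q) oJK iJK _ eq (xi := xi)) => //.
    by move=> u [Ju _]; exact: lj.
  by move=> u [_ Ku]; exact: lk.
have sol_mull J j g : sol J j -> sol J (fun s => g * j s)%lg.
  by move=> [oJ iJ lj]; split=> // s Js; apply: logder_mull; exact: lj.
pose reach t := exists J j, [/\ sol J j, J t0, J t & j t0 = (@lg_one R H)].
(* The solution [k] is left-translated to meet [j] at [q]. The two then agree on the interval where
   both live, and the union of the domains is an interval because both contain [q]. *)
have extend (K : set R) k q s : sol K k -> K q -> K s -> reach q -> reach s.
  move=> solK Kq Ks [J [j [solJ Jt0 Jq jt0]]].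
  pose k' u := (j q * ((k q)^-1 * k u))%lg.
  have solK' : sol K k' by exact: (sol_mull _ _ _ (sol_mull _ _ _ solK)).
  have kq : j q = k' q by rewrite /k' lg_mulV lg_mulr1.
  have agree := sol_unique _ _ _ _ _ solJ solK' Jq Kq kq.
  pose i u := if pselect (J u) then j u else k' u.
  have iJE u : J u -> i u = j u by rewrite /i; case: pselect.
  have iKE u : K u -> i u = k' u.
    by rewrite /i; case: pselect => // Ju Ku; exact: agree.
  exists (J `|` K), i; split; [|by left|by right|by rewrite iJE].
  have [oJ iJ lj] := solJ; have [oK iK lk] := solK'.
  split; first exact: openU.
    move=> x y Jx Jy z /andP[xz zy].
    case: Jx => [Jx|Kx]; case: Jy => [Jy|Ky].
    - by left; apply: (iJ x y) => //; apply/andP.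
    - case: (leP z q) => zq.
        by left; apply: (iJ x q) => //; apply/andP.
      by right; apply: (iK q y) => //; apply/andP; split=> //; exact: ltW.
    - case: (leP z q) => zq.
        by right; apply: (iK x q) => //; apply/andP.
      by left; apply: (iJ q y) => //; apply/andP; split=> //; exact: ltW.
    - by right; apply: (iK x y) => //; apply/andP.
  move=> u [Ju|Ku].
    apply: (logder_near (j := j)) (lj u Ju).
    have : nbhs u J by exact: open_nbhs_nbhs.
    by apply: filterS => w /iJE.
  apply: (logder_near (j := k')) (lk u Ku).
  have : nbhs u K by exact: open_nbhs_nbhs.
  by apply: filterS => w /iKE.
have loc t : I t -> exists K k, [/\ sol K k, K t, nbhs t K & k t = (@lg_one R H)].
  move=> It; have [k kt /nbhs_ballP[d /= d0 dk]] := logder_local_exists (sxi t It).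
  exists (ball t d), k; split=> //; [|exact: ballxx|exact: nbhsx_ballx].
  split; [exact: ball_open| |by move=> s /dk].
  move=> x y; rewrite -ball_normE /ball_/= !ltr_distlC => /andP[x1 _] /andP[_ y2].
  move=> z /andP[xz zy]; rewrite ltr_distlC.
  by rewrite (lt_le_trans x1 xz) (le_lt_trans zy y2).
have R0 : reach t0.
  by have [K [k [solK Kt _ kt]]] := loc t0 It0; exists K, k.
have RI : forall t, I t -> reach t.
  apply: (connected_locally_const oI iI (q := t0)) => // t It.
  have [K [k [solK Kt nK _]]] := loc t It.
  (* The same local solution carries reachability from [t] to nearby points and back. *)
  by apply: filterS nK => s Ks; split; exact: (extend K k).
(* Each value comes from some solution reaching [t], a priori a different one for each [t];
   uniqueness ([jE]) makes the choice irrelevant. *)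
pose j t : H := match pselect (reach t) with
  | left r => projT1 (cid (projT2 (cid r))) t | right _ => (@lg_one R H) end.
have jE J k t : sol J k -> J t0 -> k t0 = (@lg_one R H) -> J t -> j t = k t.
  move=> solJ Jt0 kt0 Jt; rewrite /j; case: pselect => [r|[]]; last by exists J, k.
  case: (projT2 (cid (projT2 (cid r)))) => sol' t0' t' e'.
  by apply: (sol_unique _ _ _ _ t0 sol' solJ) => //; rewrite e' kt0.
exists j.
  by have [J [k [solJ Jt0 _ kt0]]] := R0; rewrite (jE J k).
move=> t It; have [J [k [solJ Jt0 Jt kt0]]] := RI t It.
have [oJ _ lk] := solJ; apply: (logder_near (j := k)) (lk t Jt).
have : nbhs t J by exact: open_nbhs_nbhs.
by apply: filterS => s Js; rewrite (jE J k).
Qed.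

(** The translated curve j(t)^-1 j solves a smooth equation in the chart, hence is smooth; j^-1 is
    recovered from it by a translation and an inversion. *)
Lemma smooth_logder_inv (xi : R -> E) (j : R -> H) (t : R) (d : chart H E) :
  smooth_near xi t -> (\forall s \near t, logder c j s (xi s)) ->
  lg_atlas d -> dom d (j t)^-1%lg ->
  smooth_near (fun s => fwd d (j s)^-1%lg) t.
Proof.
move=> sxi lj Ad djt; have [cj _] := nbhs_singleton lj.
have N := near_translate Ac c1 cj.
pose y s := fwd c ((j t)^-1 * j s)%lg.
have yt : y t = e by rewrite /y lg_mulV.
have sy : smooth_near y t.
  apply: (@ode_smooth _ _ (fun p : R * E => left_inv_field c (xi p.1) p.2)).
    by rewrite yt; exact: smooth_near_left_inv_field.
  by apply: filterS2 lj N => s ls ds; exact: logder_chart.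
apply: (@smooth_near_eq _ _ _ (fun s => fwd d (j t * bwd c (y s))^-1%lg)).
  by apply: filterS N => s ds; rewrite /y cK// lg_mulVK.
apply: (@smooth_near_comp _ _ _ _ y (fun z => fwd d (j t * bwd c z)^-1%lg)) => //.
rewrite yt; have [_] := @smooth_at_comp _ _ (fun z => j t * z)%lg (@lg_inv R H)
  (@lg_one R H) (smooth_at_mull _ _) (smooth_at_inv _).
by apply=> //; rewrite lg_mulr1.
Qed.

End development.

(** * LA-homotopies *)

Section linear_smooth.
Variable R : realType.

(** Expansion in the standard basis; with [g] the identity it also yields the continuity of [L]. *)
Lemma smooth_near_linear_row (E F : normedModType R) n (g : E -> 'rV[R]_n)
    (L : {linear 'rV[R]_n -> F}) x :
  smooth_near g x -> smooth_near (fun y => L (g y)) x.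
Proof.
move=> sg.
have -> : (fun y => L (g y)) = (fun y => \sum_i g y 0 i *: L (delta_mx 0 i)).
  apply/funext => y; rewrite {1}(row_sum_delta (g y)) linear_sum.
  by apply: eq_bigr => i _; rewrite linearZ.
elim: (index_enum _) => [|i r IH].
  under eq_fun do rewrite big_nil; exact: smooth_near_cst.
under eq_fun do rewrite big_cons.
apply: smooth_near_add => //; apply: smooth_near_scale.
  exact: smooth_near_coord.
exact: smooth_near_cst.
Qed.

Lemma vecof_comp_linear (V : vectType R) n (L : {linear V -> 'rV[R]_n}) :
  linear (fun v => L (passmx.vecof (vbasis {:V}) v)).
Proof. by move=> a u v; rewrite passmx.vecof_linear linearP. Qed.

(** Passage from the basis used in [vsmooth] to arbitrary linear coordinates, such as [int_iso]. *)
Lemma vsmooth_near (E : normedModType R) (V : vectType R) n (U : set E)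
    (f : E -> V) (L : {linear V -> 'rV[R]_n}) x :
  open U -> vsmooth U f -> U x -> smooth_near (fun y => L (f y)) x.
Proof.
move=> oU fU Ux; pose b := vbasis {:V}.
pose M : {linear 'rV[R]_(\dim {:V}) -> 'rV[R]_n} :=
  HB.pack (fun v => L (passmx.vecof b v)) (GRing.isLinear.Build _ _ _ _ _
    (vecof_comp_linear L)).
have -> : (fun y => L (f y)) = (fun y => M (passmx.rVof b (f y))).
  by apply/funext => y /=; rewrite passmx.rVofK//; exact: vbasisP.
by apply: (@smooth_near_linear_row _ _ _ (fun y => passmx.rVof b (f y)) M); exists U.
Qed.

Lemma vsmooth_cst (E : normedModType R) (V : vectType R) (U : set E) (v : V) :
  vsmooth U (fun=> v).
Proof. by move=> k; exact: Ck_cst. Qed.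

End linear_smooth.

Section lie_bracket.
Variables (R : realType) (h : lieAlgebra R).

Lemma lie_br0l (x : h) : lie_br 0 x = 0.
Proof. by have := lie_br_linl x (-1) 0 0; rewrite scaler0 addr0 scaleN1r addNr. Qed.

Lemma lie_brDl (x y z : h) : lie_br (x + y) z = lie_br x z + lie_br y z.
Proof. by have := lie_br_linl z 1 x y; rewrite !scale1r. Qed.

Lemma lie_brZl a (x z : h) : lie_br (a *: x) z = a *: lie_br x z.
Proof. by have := lie_br_linl z a x 0; rewrite lie_br0l !addr0. Qed.

Lemma lie_br0r (x : h) : lie_br x 0 = 0.
Proof. by have := lie_br_linr x (-1) 0 0; rewrite scaler0 addr0 scaleN1r addNr. Qed.

Lemma lie_brDr (x y z : h) : lie_br z (x + y) = lie_br z x + lie_br z y.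
Proof. by have := lie_br_linr z 1 x y; rewrite !scale1r. Qed.

Lemma lie_brZr a (x z : h) : lie_br z (a *: x) = a *: lie_br z x.
Proof. by have := lie_br_linr z a x 0; rewrite lie_br0r !addr0. Qed.

Lemma lie_br_suml n (f : 'I_n -> h) z :
  lie_br (\sum_i f i) z = \sum_i lie_br (f i) z.
Proof.
apply: (big_morph (fun x => lie_br x z)); [move=> x y; exact: lie_brDl|exact: lie_br0l].
Qed.

Lemma lie_br_sumr n (f : 'I_n -> h) z :
  lie_br z (\sum_i f i) = \sum_i lie_br z (f i).
Proof.
apply: (big_morph (lie_br z)); [move=> x y; exact: lie_brDr|exact: lie_br0r].
Qed.

End lie_bracket.

Section homotopy.
Variables (R : realType) (g h : lieAlgebra R) (I : set R).
Variable Phi : R -> 'Hom((R^o * g)%type, h).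
Hypotheses (oI : open I) (Phi_LA : LA_homotopy I Phi).

Lemma homotopy_smooth_near n (L : {linear h -> 'rV[R]_n}) (p : (R^o * g)%type) s :
  I s -> smooth_near (fun t => L (Phi t p)) s.
Proof.
have [_ sPhi _ _] := Phi_LA.
pose ev (T : 'Hom((R^o * g)%type, h)) := L (T p).
have lev : linear ev by move=> a S T; rewrite /ev !lfunE/= !lfunE/= linearP.
pose evL : {linear 'Hom((R^o * g)%type, h) -> 'rV[R]_n} :=
  HB.pack ev (GRing.isLinear.Build _ _ _ _ _ lev).
exact: (vsmooth_near evL oI sPhi).
Qed.

(** [bracket_compatible] for the constant sections [p] and [p']: the [u] are the coordinates of
    [Phi t p] in [vbasis] and the [b] are the basis vectors. Derivatives of constants vanish, so the
    bracket of the sections is (0, [x, y]); the anchor terms reassemble into derivatives of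
    [Phi t p'] and [Phi t p]. *)
Lemma homotopy_bracket (p p' : (R^o * g)%type) s : I s ->
  Phi s (0, lie_br p.2 p'.2) = lie_br (Phi s p) (Phi s p')
    + passmx.vecof (vbasis {:h})
        ('D_(p.1 : R) (fun t => passmx.rVof (vbasis {:h}) (Phi t p')) s)
    - passmx.vecof (vbasis {:h})
        ('D_(p'.1 : R) (fun t => passmx.rVof (vbasis {:h}) (Phi t p)) s).
Proof.
move=> Is; have [_ _ _ brPhi] := Phi_LA.
pose u (q : (R^o * g)%type) i (t : R) : R := coord (vbasis {:h}) i (Phi t q).
have su q t : I t -> smooth_near (fun t => passmx.rVof (vbasis {:h}) (Phi t q)) t.
  pose r : {linear h -> 'rV[R]_(\dim {:h})} := HB.pack (passmx.rVof (vbasis {:h}))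
    (GRing.isLinear.Build _ _ _ _ _ (passmx.rVof_linear (vbasis {:h}))).
  exact: (homotopy_smooth_near r).
have ucoord q i : u q i = (fun t => passmx.rVof (vbasis {:h}) (Phi t q) 0 i).
  by apply/funext => t; rewrite mxE.
have uI q i : smooth I (u q i).
  by apply: smooth_nearP => t It; rewrite ucoord; apply: smooth_near_coord; exact: su.
have dec q t : Phi t q = \sum_i u q i t *: (vbasis {:h})`_i.
  by apply: coord_vbasis; rewrite memvf.
pose b (i : 'I_(\dim {:h})) : 'rV[R]_0 -> h := fun=> (vbasis {:h})`_i.
have := brPhi (fun=> p) (fun=> p') _ _ (u p) b (u p') b
  (@vsmooth_cst R _ _ _ _) (@vsmooth_cst R _ _ _ _) (uI p)
  (fun i => @vsmooth_cst R _ _ _ _) (uI p') (fun i => @vsmooth_cst R _ _ _ _)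
  (fun t _ => dec p t) (fun t _ => dec p' t) s Is.
rewrite /= /la_act /=.
have vd (x : g) : vderiv (fun=> x) s = 0.
  rewrite /vderiv derive_cst /passmx.vecof big1// => i _.
  by rewrite mxE scale0r.
rewrite !vd !scaler0 subr0 addr0.
have -> : 'D_1 (fun=> p'.1 : R) s = 0 by exact: derive_cst.
have -> : 'D_1 (fun=> p.1 : R) s = 0 by exact: derive_cst.
rewrite !mulr0 subr0 => ->; congr (_ + _ - _).
- rewrite [in RHS](dec p) [in RHS](dec p') lie_br_suml.
  apply: eq_bigr => i _; rewrite lie_br_sumr; apply: eq_bigr => j _.
  by rewrite lie_brZl lie_brZr scalerA.
- apply: eq_bigr => i _; rewrite derive_coord; last first.
    exact/smooth_near_differentiable/su.
  by rewrite ucoord.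
- apply: eq_bigr => i _; rewrite derive_coord; last first.
    exact/smooth_near_differentiable/su.
  by rewrite ucoord.
Qed.

Lemma homotopy_is_lie_morphism s : I s ->
  forall x y : g, Phi s (0, lie_br x y) = lie_br (Phi s (0, x)) (Phi s (0, y)).
Proof.
move=> Is x y; rewrite (homotopy_bracket (0, x) (0, y) Is) /=.
rewrite !derive0 /passmx.vecof !big1 ?subr0 ?addr0// => i _; by rewrite mxE scale0r.
Qed.

(** The bracket identity for d/dt and the constant section x, whose bracket is zero. Arbitrary
    coordinates [L] make it directly usable with [int_iso]. *)
Lemma homotopy_derive s n (L : {linear h -> 'rV[R]_n}) (x : g) : I s ->
  is_derive (s : R) 1 (fun t => L (Phi t (0, x)))
    (- L (lie_br (Phi s (1, 0)) (Phi s (0, x)))).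
Proof.
move=> Is; pose b := vbasis {:h}; pose y t := passmx.rVof b (Phi t (0, x)).
have := homotopy_bracket (1, 0) (0, x) Is; rewrite /= lie_br0l derive0.
have -> : passmx.vecof b 0 = 0.
  by rewrite /passmx.vecof big1// => i _; rewrite mxE scale0r.
rewrite subr0 -[(0, 0)]/(0 : (R^o * g)%type) linear0 => /esym/eqP.
rewrite addrC addr_eq0 => /eqP e.
pose M : {linear 'rV[R]_(\dim {:h}) -> 'rV[R]_n} :=
  HB.pack (fun v => L (passmx.vecof b v)) (GRing.isLinear.Build _ _ _ _ _
    (vecof_comp_linear L)).
pose rv : {linear h -> 'rV[R]_(\dim {:h})} := HB.pack (passmx.rVof b)
  (GRing.isLinear.Build _ _ _ _ _ (passmx.rVof_linear b)).
have yE : (fun t => L (Phi t (0, x))) = (fun t => M (y t)).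
  by apply/funext => t /=; rewrite passmx.rVofK//; exact: vbasisP.
have dy : differentiable y s.
  by apply: smooth_near_differentiable; exact: (homotopy_smooth_near rv).
have cM : continuous M.
  move=> v; apply: smooth_near_continuous.
  exact: (smooth_near_linear_row M (smooth_near_id v)).
have dM v : differentiable M v by exact: linear_differentiable.
have iy : is_derive s 1 y ('D_1 y s) by exact: differentiable_is_derive.
have := is_derive_comp_curve iy (dM (y s)).
rewrite yE -linearN -e (deriveE _ (dM _)) (diff_lin (y s) cM).
exact.
Qed.

End homotopy.

Lemma derive0_const (R : realType) n (f : R -> 'rV[R]_n) (I : set R) (a b : R) :
  is_interval I -> (forall t, I t -> is_derive t 1 f 0) -> I a -> I b ->
  f a = f b.
Proof.
move=> iI df Ia Ib; wlog ab : a b Ia Ib / a <= b.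
  move=> W; have [ab|/ltW ba] := leP a b; first exact: W.
  by apply/esym; exact: W.
have := @mean_value_le R n f (fun=> 0) 0 a b ab (lexx _).
rewrite mul0r => h.
have {h} : `|f b - f a| <= 0.
  apply: h => t tab; last by rewrite normr0.
  by apply: df; exact: (iI a b).
by rewrite normr_le0 subr_eq0 => /eqP.
Qed.

(** * The trivialising curve *)

Section trivialization.
Variables (R : realType) (g h : lieAlgebra R) (I : set R).
Variables (H : lieGroup R) (i : integrates H h).
Variable Phi : R -> 'Hom((R^o * g)%type, h).
Hypotheses (oI : open I) (iI : is_interval I) (I0 : I 0).
Hypothesis Phi_LA : LA_homotopy I Phi.
Let c := int_chart i.
(** The curves c and psi(x), carried to the tangent space of [H] at 1. *)
Let xi (s : R) := int_iso i (Phi s (1, 0)).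
Let w (x : g) (s : R) := int_iso i (Phi s (0, x)).

(* j solves j^-1 j' = xi; then Ad_j(psi x) is constant because
   (Ad_j w)' = Ad_j([xi, w] + w') = 0. *)
Lemma trivialization_exists : exists j : R -> H,
  [/\ forall t, I t -> logder c j t (xi t) &
      forall t, I t -> forall x,
        w x t = chart_Ad c (lg_inv (j t)) (w x 0)].
Proof.
have Ac : lg_atlas c := int_chart_atlas i.
have c1 : dom c (@lg_one R H) := int_chart_one i.
have sxi t : I t -> smooth_near xi t.
  by move=> It; exact: (homotopy_smooth_near oI Phi_LA).
have [j j0 lj] := logder_global_exists Ac c1 oI iI I0 sxi.
exists j; split=> // t It x.
pose G s := chart_Ad c (j s) (w x s).
have dG s : I s -> is_derive s 1 G 0.
  move=> Is; have [cj dj] := lj s Is.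
  have N := near_translate Ac c1 cj.
  pose y u := fwd c (lg_mul (lg_inv (j s)) (j u)).
  have ys : y s = fwd c (@lg_one R H) by rewrite /y lg_mulV.
  have dw : is_derive s 1 (w x) (- tangent_br c (xi s) (w x s)).
    rewrite /tangent_br -[X in - X]int_iso_br.
    exact: (homotopy_derive oI Phi_LA).
  have := is_derive_chart_Ad Ac c1 ys dj dw; rewrite subrr => dA.
  (* The derivative was computed for j(s)^-1 j, which passes through 1 at time [s]; the linear map
     Ad of j(s) brings it back to [G]. *)
  pose L : {linear 'rV[R]_(lg_dim H) -> 'rV[R]_(lg_dim H)} := HB.pack (chart_Ad c (j s))
    (GRing.isLinear.Build _ _ _ _ _ (chart_Ad_linear Ac c1 (j s))).
  have dL v : differentiable L v.
    apply: smooth_near_differentiable.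
    exact: (smooth_near_linear_row L (smooth_near_id v)).
  have := is_derive_comp_curve dA (dL _); rewrite derive0.
  apply: near_eq_is_derive; apply: filterS N => u du.
  have [K _ _ _ _] := atlas_chart_at Ac c1.
  by rewrite /= /y (K _ du) -(chart_AdM Ac c1) lg_mulVK.
have := derive0_const iI dG It I0.
rewrite /G j0 chart_Ad1// => <-.
by rewrite -chart_AdM// lg_mulV chart_Ad1.
Qed.

End trivialization.

Unset Implicit Arguments.

Theorem proposition4p4 (R : realType) (g h : lieAlgebra R)
  (I : set R) (I_itv : open_interval I) (I0 : I 0) (I1 : I 1)
  (H : lieGroup R) (H_sc : simply_connected R H) (H_h : integrates H h)
  (Phi : R -> 'Hom((R^o * g)%type, h)) (Phi_LA : LA_homotopy I Phi)
  (psi : R -> 'Hom(g, h))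
  (psiE : forall s, I s -> forall x : g, psi s x = Phi s (0, x)) :
  is_trivial_deformation I H_h (psi 0) psi.
Proof.
have [oI iI] := I_itv.
have psi_lie t : I t -> is_lie_morphism (psi t).
  move=> It x y; rewrite !psiE//; exact: (homotopy_is_lie_morphism oI Phi_LA It).
have Ac := int_chart_atlas H_h; have c1 := int_chart_one H_h.
split.
  split=> //; first exact: psi_lie.
  have [_ sPhi _ _] := Phi_LA.
  (* On [I], [psi s] is [Phi s] composed with x -> (0, x), an operation linear in [Phi s], so
     smoothness is inherited. *)
  pose inj : 'Hom(g, (R^o * g)%type) := linfun (fun x : g => (0 : R^o, x)).
  pose T (F : 'Hom((R^o * g)%type, h)) := passmx.rVof (vbasis {:'Hom(g, h)}) (F \o inj)%VF.
  have lT : linear T.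
    move=> a F F'; rewrite /T comp_lfunDl -comp_lfunZl.
    by rewrite passmx.rVof_linear.
  pose TL : {linear 'Hom((R^o * g)%type, h) -> 'rV[R]_(\dim {:'Hom(g, h)})} :=
    HB.pack T (GRing.isLinear.Build _ _ _ _ _ lT).
  have linj : linear (fun x : g => (0 : R^o, x)).
    by move=> a x y; congr (_, _); rewrite /= ?scaler0 ?addr0.
  have injE x : inj x = (0, x).
    pose il : {linear g -> (R^o * g)%type} := HB.pack (fun x : g => (0 : R^o, x))
      (GRing.isLinear.Build _ _ _ _ _ linj).
    exact: (lfunE il).
  apply: smooth_nearP => t It.
  apply: (@smooth_near_eq _ _ _ (fun s => TL (Phi s))).
    have : nbhs t I by exact: open_nbhs_nbhs.
    apply: filterS => s Is; rewrite /= /T; congr (passmx.rVof _ _).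
    by apply/lfunP => x; rewrite comp_lfunE injE psiE.
  exact: (vsmooth_near TL oI sPhi).
have [j [lj jE]] := trivialization_exists H_h oI iI I0 Phi_LA.
exists (fun t => lg_inv (j t)); split; last first.
  move=> t It x; rewrite (psiE t It x) -[LHS](int_isoK H_h) (jE t It x).
  by rewrite /Ad (psiE 0 I0).
split.
  move=> t It; have [cj _] := lj t It.
  exact: (@continuous_comp _ _ _ j (@lg_inv R H) t cj (@lg_inv_continuous _ _ _)).
move=> c d -> Ad /=; apply: smooth_nearP => t [s [[_ Is] ds] <-] /=.
apply: (@smooth_logder_inv _ _ _ Ac c1 (fun s => int_iso H_h (Phi s (1, 0))) j s d) => //.
  exact: (homotopy_smooth_near oI Phi_LA).
have : nbhs s I by exact: open_nbhs_nbhs.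
by apply: filterS => u Iu; exact: lj.
Qed.
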